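(* Let $I=[0,1]$ and let $\mathrm{Diff}_+^1(I)$ be the topological group of orientation-preserving $C^1$-diffeomorphisms of $I$, with the $C^1$ topology. Then there exists a finitely generated subgroup of $\mathrm{Diff}_+^1(I)$ which is dense in $\mathrm{Diff}_+^1(I)$.
   Context: $\mathrm{Diff}_+^1(I)$ is the group, under composition, of $C^1$ bijections $f:[0,1]\to[0,1]$ with $f(0)=0$, $f(1)=1$ and $f'>0$ on $[0,1]$ (one-sided derivatives at the endpoints). The $C^1$ topology is induced by the metric $d(f,g)=\sup_{x\in I}|f'(x)-g'(x)|$. *)

(* Defs.v *)
From HB Require Import structures.
From mathcomp Require Import all_boot all_order all_algebra.
From mathcomp Require Import all_classical all_reals all_analysis.
From mathcomp Require Import ring lra.

Set Implicit Arguments.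
Unset Strict Implicit.
Unset Printing Implicit Defensive.

Import Order.TTheory GRing.Theory Num.Theory.
Import numFieldNormedType.Exports.

Local Open Scope classical_set_scope.
Local Open Scope ring_scope.

Section subgroups.
Variable gT : groupType.
Implicit Types A H : set gT.

Definition is_subgroup H : Prop := group_closed (mem H).

Definition generated_subgroup A : set gT := smallest is_subgroup A.

Definition finitely_generated H : Prop :=
  exists A, finite_set A /\ H = generated_subgroup A.

Lemma is_subgroupP H : is_subgroup H <->
  [/\ H 1%g, forall x y, H x -> H y -> H (x * y)%g & forall x, H x -> H x^-1%g].
Proof.
split=> [Hg|[H1 HM HV]].
  have [HV HM] := (group_closedV Hg, group_closedM Hg).
  split=> [|x y /mem_set Hx /mem_set Hy|x /mem_set Hx]; apply: set_mem.
  - exact: Hg.1.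
  - exact: HM.
  - exact: HV.
split=> [|x y /set_mem Hx /set_mem Hy]; apply: mem_set => //.
exact/HM/HV.
Qed.

Lemma generated_is_subgroup A : is_subgroup (generated_subgroup A).
Proof.
apply/is_subgroupP; split=> [|x y Hx Hy|x Hx] H [/[dup]/is_subgroupP[H1 HM HV]].
- by [].
- by move=> gH AH; apply: HM; [apply: Hx|apply: Hy].
- by move=> gH AH; apply: HV; apply: Hx.
Qed.

End subgroups.

Section derivative_on_the_unit_interval.
Variable R : realType.
Implicit Types (f g : R -> R) (x y l m : R).

Definition quotI f x y : R := (f y - f x) / (y - x).

(* The limit is taken within [0, 1], hence it is one-sided at 0 and at 1. *)
Definition derivableI f x : Prop :=
  cvg (quotI f x y @[y --> within `[0, 1] x^']).

Definition derivI f x : R := lim (quotI f x y @[y --> within `[0, 1] x^']).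

Definition is_derivI f x l : Prop :=
  quotI f x y @[y --> within `[0, 1] x^'] --> l.

Lemma is_derivIP f x l : is_derivI f x l <->
  forall e, 0 < e -> exists2 d, 0 < d & forall y, 0 <= y <= 1 ->
    `|y - x| < d -> `|f y - f x - l * (y - x)| <= e * `|y - x|.
Proof.
rewrite /is_derivI; split=> [/cvgrPdist_le H e e0|H].
  have /= := H _ e0; rewrite near_withinE /dnbhs near_withinE.
  case/nbhs_ballP => d /= d0 dP; exists d => // y y01 yx.
  have [->|nyx] := eqVneq y x; first by rewrite !subrr mulr0 subr0 normr0 mulr0.
  have yx0 : y - x != 0 by rewrite subr_eq0.
  have /= := dP y; rewrite /ball /= distrC => /(_ yx nyx); rewrite in_itv /=.
  move=> /(_ y01); rewrite distrC /quotI => dq.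
  rewrite (_ : _ - _ - _ = ((f y - f x) / (y - x) - l) * (y - x)); last by field.
  by rewrite normrM ler_wpM2r.
apply/cvgrPdist_le => e e0; have [d d0 dP] := H _ e0.
rewrite near_withinE /dnbhs near_withinE; apply/nbhs_ballP; exists d => //= y.
rewrite /ball /= distrC => yx nyx; rewrite in_itv /= => y01.
have yx0 : y - x != 0 by rewrite subr_eq0.
rewrite -(@ler_pM2r _ `|y - x|) ?normr_gt0 // distrC -normrM.
rewrite (_ : (_ - l) * _ = f y - f x - l * (y - x)); first exact: dP.
by rewrite /quotI; field.
Qed.

Lemma within_dnbhs_proper x : 0 <= x <= 1 -> ProperFilter (within `[0, 1] x^').
Proof.
move=> /andP[x0 x1]; apply: Build_ProperFilter_ex => P.
rewrite /dnbhs /within /= => /nbhs_ballP[d /= d0 dP].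
pose m := Num.min (d / 2) (1 / 2).
have m0 : 0 < m by rewrite lt_min; apply/andP; split; lra.
have md : m < d by rewrite gt_min; apply/orP; left; lra.
have m12 : m <= 1 / 2 by rewrite ge_min lexx orbT.
have [xl|xl] := lerP x (1 / 2).
  exists (x + m); apply: dP => /=.
  - by rewrite /ball /= opprD addrA subrr sub0r normrN gtr0_norm.
  - by rewrite -subr_eq0 addrC addKr gt_eqF.
  - by rewrite in_itv /=; lra.
exists (x - m); apply: dP => /=.
- by rewrite /ball /= opprB addrC subrK gtr0_norm.
- by rewrite -subr_eq0 addrC addKr oppr_eq0 gt_eqF.
- by rewrite in_itv /=; lra.
Qed.

Lemma is_derivI_derivI f x l : 0 <= x <= 1 -> is_derivI f x l -> derivI f x = l.
Proof.
move=> x01 fl; have := within_dnbhs_proper x01 => Fx; exact: cvg_lim fl.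
Qed.

Lemma derivableIP f x : derivableI f x -> is_derivI f x (derivI f x).
Proof. by []. Qed.

Lemma is_derivI_derivable f x l : is_derivI f x l -> derivableI f x.
Proof. by move=> fl; apply/cvg_ex; exists l. Qed.

Lemma is_derivI_lip f x l : is_derivI f x l ->
  exists2 d, 0 < d & forall y, 0 <= y <= 1 ->
    `|y - x| < d -> `|f y - f x| <= (`|l| + 1) * `|y - x|.
Proof.
move=> /is_derivIP /(_ 1 ltr01)[d d0 dP]; exists d => // y y01 yx.
have := dP y y01 yx; rewrite mul1r => H.
rewrite (_ : f y - f x = (f y - f x - l * (y - x)) + l * (y - x)); last by ring.
by rewrite (le_trans (ler_normD _ _)) // normrM mulrDl mul1r addrC lerD2l.
Qed.

Definition contI f x := forall e, 0 < e -> exists2 d, 0 < d &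
  forall y, 0 <= y <= 1 -> `|y - x| < d -> `|f y - f x| <= e.

Lemma contIP f : {within `[0, 1], continuous f} <->
  forall x, 0 <= x <= 1 -> contI f x.
Proof.
split=> [/subspace_continuousP cf x x01 e e0|cf].
  have /cvgrPdist_le /(_ _ e0) := cf x x01; rewrite near_withinE.
  case/nbhs_ballP => d /= d0 dP; exists d => // y y01 yx.
  by rewrite distrC; apply: dP => //; rewrite /ball /= distrC.
apply/subspace_continuousP => x /= x01; apply/cvgrPdist_le => e e0.
have x01' : 0 <= x <= 1 by rewrite in_itv in x01.
have [d d0 dP] := cf x x01' e e0.
rewrite near_withinE; apply/nbhs_ballP; exists d => //= y; rewrite /ball /=.
by rewrite in_itv /= distrC => yx y01; rewrite distrC; exact: dP.
Qed.

Lemma is_derivI_cont f x l : is_derivI f x l -> contI f x.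
Proof.
move=> /is_derivI_lip[d d0 dP] e e0.
have l0 : 0 < `|l| + 1 by rewrite ltr_wpDl.
exists (Num.min d (e / (`|l| + 1))); first by rewrite lt_min d0 divr_gt0.
move=> y y01; rewrite lt_min => /andP[yd ye].
by rewrite (le_trans (dP y y01 yd)) // mulrC -ler_pdivlMr // ltW.
Qed.

Lemma is_derivI_comp f g x l m : (forall y, 0 <= y <= 1 -> 0 <= f y <= 1) ->
  is_derivI f x l -> is_derivI g (f x) m -> is_derivI (g \o f) x (m * l).
Proof.
move=> fI fl gm; apply/is_derivIP => e e0.
have [d1 d10 d1P] := is_derivI_lip fl.
have l0 : 0 < `|l| + 1 by rewrite ltr_wpDl.
have m0 : 0 < `|m| + 1 by rewrite ltr_wpDl.
have e1 : 0 < e / 2 / (`|l| + 1) by rewrite !divr_gt0.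
have e2 : 0 < e / 2 / (`|m| + 1) by rewrite !divr_gt0.
have /is_derivIP /(_ _ e1)[d2 d20 d2P] := gm.
have /is_derivIP /(_ _ e2)[d3 d30 d3P] := fl.
have [d4 d40 d4P] := is_derivI_cont fl (divr_gt0 d20 (ltr0Sn R 1)).
exists (Num.min (Num.min d1 d3) d4); first by rewrite !lt_min d10 d30 d40.
move=> y y01; rewrite !lt_min => /andP[/andP[yd1 yd3] yd4] /=.
have fyx : `|f y - f x| < d2 by have := d4P y y01 yd4; lra.
have A := d2P _ (fI _ y01) fyx.
have B := d3P _ y01 yd3.
have C := d1P _ y01 yd1.
rewrite (_ : _ - _ = (g (f y) - g (f x) - m * (f y - f x)) +
  m * (f y - f x - l * (y - x))); last by ring.
rewrite (le_trans (ler_normD _ _)) // (splitr e) mulrDl lerD //.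
  rewrite (le_trans A) // -[leRHS](_ : e / 2 / (`|l| + 1) *
    ((`|l| + 1) * `|y - x|) = _); first by rewrite ler_wpM2l // ltW.
  by rewrite mulrA divfK // gt_eqF.
rewrite normrM (@le_trans _ _ ((`|m| + 1) * (e / 2 / (`|m| + 1) * `|y - x|))) //.
  by rewrite ler_pM // lerDl.
by rewrite mulrA [X in X * _]mulrC divfK // gt_eqF.
Qed.

Lemma is_derivI_inverse f g x l : 0 < l ->
  (forall y, 0 <= y <= 1 -> 0 <= g y <= 1) ->
  (forall y, 0 <= y <= 1 -> f (g y) = y) -> g (f x) = x ->
  0 <= x <= 1 -> 0 <= f x <= 1 ->
  contI g (f x) -> is_derivI f x l -> is_derivI g (f x) l^-1.
Proof.
move=> l0 gI gK gfx x01 fx01 cg /is_derivIP fl; apply/is_derivIP => e e0.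
pose e' := Num.min (l / 2) (e * l ^+ 2 / 2).
have e'0 : 0 < e'.
  by rewrite lt_min !divr_gt0 // mulr_gt0 // exprn_gt0.
have e'l : e' <= l / 2 by rewrite ge_min lexx.
have e'e : e' <= e * l ^+ 2 / 2 by rewrite ge_min lexx orbT.
have [d d0 dP] := fl _ e'0.
have [d2 d20 d2P] := cg _ (divr_gt0 d0 (ltr0Sn R 1)).
exists d2 => // y y01 yd2; set w := g y.
have wd : `|w - x| < d by have := d2P y y01 yd2; rewrite gfx -/w; lra.
have := dP w (gI _ y01) wd; rewrite gK // gfx => A.
have B : l / 2 * `|w - x| <= `|y - f x|.
  have C : l * `|w - x| <= `|y - f x| + e' * `|w - x|.
    rewrite -{1}(gtr0_norm l0) -normrM.
    rewrite (_ : l * (w - x) = (y - f x) - (y - f x - l * (w - x))); last by ring.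
    by rewrite (le_trans (ler_normB _ _)) // lerD2l.
  have D : e' * `|w - x| <= l / 2 * `|w - x| by rewrite ler_wpM2r.
  lra.
rewrite (_ : w - x - l^-1 * (y - f x) = - l^-1 * (y - f x - l * (w - x)));
  last by field; rewrite gt_eqF.
rewrite normrM normrN (@gtr0_norm _ l^-1) ?invr_gt0 // ler_pdivrMl //.
rewrite (le_trans A) // (@le_trans _ _ (e * l ^+ 2 / 2 * `|w - x|)) //.
  by rewrite ler_wpM2r.
rewrite (_ : e * l ^+ 2 / 2 * _ = e * l * (l / 2 * `|w - x|)); last by field.
by rewrite [leRHS](_ : _ = e * l * `|y - f x|); [rewrite ler_pM2l // mulr_gt0|ring].
Qed.

Lemma is_derivI_is_derive f x l : 0 < x < 1 -> is_derivI f x l ->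
  is_derive x 1 f l.
Proof.
move=> /andP[x0 x1] /is_derivIP fl.
suff H : h^-1 *: (f (h *: 1 + x) - f x) @[h --> 0^'] --> l.
  by apply: DeriveDef; [apply/cvg_ex; exists l|exact: cvg_lim H].
apply/cvgrPdist_le => e e0; have [d d0 dP] := fl _ e0.
pose m := Num.min d (Num.min x (1 - x)).
have m0 : 0 < m by rewrite !lt_min d0 x0 subr_gt0.
rewrite /dnbhs near_withinE; apply/nbhs_ballP; exists m => //= h.
rewrite /ball /= sub0r normrN !lt_min => /andP[hd /andP[hx hx1]] h0.
have [hxa hxb] := (ltr_normlP _ _ hx, ltr_normlP _ _ hx1).
have y01 : 0 <= h + x <= 1 by move: hxa hxb => [? ?] [? ?]; lra.
have := dP _ y01; rewrite addrK => /(_ hd) H.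
rewrite -(@ler_pM2r _ `|h|) ?normr_gt0 // distrC -normrM.
rewrite (_ : (_ - l) * h = f (h + x) - f x - l * h) //.
by rewrite /GRing.scale /= mulr1; field.
Qed.

Lemma derivI_eq f g : f 0 = g 0 ->
  (forall x, 0 <= x <= 1 -> derivableI f x) ->
  (forall x, 0 <= x <= 1 -> derivableI g x) ->
  (forall x, 0 <= x <= 1 -> derivI f x = derivI g x) ->
  forall x, 0 <= x <= 1 -> f x = g x.
Proof.
move=> fg0 df dg dfg x /andP[x0 x1].
have [<-//|xn0] := eqVneq 0 x.
have xgt0 : 0 < x by rewrite lt_neqAle xn0.
pose h := fun y => f y - g y.
have dh y : 0 <= y <= 1 -> is_derivI h y 0.
  move=> y01; have /derivableIP/is_derivIP A := df y y01.
  have /derivableIP/is_derivIP B := dg y y01.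
  apply/is_derivIP => e e0.
  have [d1 d10 {}A] := A _ (divr_gt0 e0 (ltr0Sn R 1)).
  have [d2 d20 {}B] := B _ (divr_gt0 e0 (ltr0Sn R 1)).
  exists (Num.min d1 d2); first by rewrite lt_min d10.
  move=> z z01; rewrite lt_min => /andP[z1 z2].
  have {}A := A z z01 z1; have {}B := B z z01 z2.
  rewrite dfg // in A; rewrite /h.
  rewrite (_ : _ - _ = (f z - f y - derivI g y * (z - y)) -
    (g z - g y - derivI g y * (z - y))); last by ring.
  rewrite (le_trans (ler_normB _ _)) //; lra.
have [c _] : exists2 c, c \in `]0, x[%R & h x - h 0 = 0 * (x - 0).
  apply: (@MVT _ h (fun=> 0)) => // [y|].
    rewrite in_itv /= => /andP[y0 yx]; apply: is_derivI_is_derive; first lra.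
    by apply: dh; lra.
  apply: (@continuous_subspaceW R R `[0, x] `[0, 1] h).
    by move=> y /=; rewrite !in_itv /=; lra.
  by apply/contIP => y y01; apply: is_derivI_cont (dh y y01).
by rewrite /h fg0 subrr subr0 mul0r => /eqP; rewrite subr_eq0 => /eqP.
Qed.

End derivative_on_the_unit_interval.

Section diffeomorphisms.
Variable R : realType.
Implicit Types (f g : R -> R) (x y : R).

(* A self-map of [0, 1] is represented by its extension by the identity to R:
   the last clause makes the representative unique, so that Leibniz equality on
   [diffC1] is equality of maps on [0, 1]. *)
Record is_diffC1 f : Prop := IsDiffC1 {
  diffC1_bij : set_bij `[0, 1] `[0, 1] f ;
  diffC1_at0 : f 0 = 0 ;
  diffC1_at1 : f 1 = 1 ;
  diffC1_derivable : forall x, x \in `[0, 1]%R -> derivableI f x ;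
  diffC1_deriv_cont : {within `[0, 1], continuous (derivI f)} ;
  diffC1_deriv_gt0 : forall x, x \in `[0, 1]%R -> 0 < derivI f x ;
  diffC1_out : forall x, x \notin `[0, 1]%R -> f x = x }.

Record diffC1 := DiffC1 {
  diffC1_fun :> R -> R ;
  diffC1P : is_diffC1 diffC1_fun }.

HB.instance Definition _ := gen_eqMixin diffC1.
HB.instance Definition _ := gen_choiceMixin diffC1.

Lemma diffC1_ext (f g : diffC1) : f =1 g -> f = g.
Proof.
case: f g => [f fP] [g gP] /= /funext fg; case: _ / fg in gP *.
by congr DiffC1; exact: Prop_irrelevance.
Qed.

Lemma is_diffC1_itv f : is_diffC1 f ->
  forall y, 0 <= y <= 1 -> 0 <= f y <= 1.
Proof.
by move=> /diffC1_bij[fI _ _] y y01; have /= := fI y; rewrite !in_itv; exact.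
Qed.

Lemma is_diffC1_inj f : is_diffC1 f -> injective f.
Proof.
move=> fP x y; have [[fI finj _] out] := (diffC1_bij fP, diffC1_out fP).
have [x01|x01] := boolP (x \in `[0, 1]%R);
  have [y01|y01] := boolP (y \in `[0, 1]%R).
- by apply: finj; apply: mem_set.
- by rewrite (out y) // => fxy; move: y01; rewrite -fxy (fI x x01).
- by rewrite (out x) // => fxy; move: x01; rewrite fxy (fI y y01).
- by rewrite !out.
Qed.

Lemma is_diffC1_surj f : is_diffC1 f -> forall y, exists x, f x = y.
Proof.
move=> fP y; have [[_ _ fs] out] := (diffC1_bij fP, diffC1_out fP).
have [y01|y01] := boolP (y \in `[0, 1]%R); last by exists y; rewrite out.
by have [x _ <-] := fs y y01; exists x.
Qed.

Lemma is_diffC1_id : is_diffC1 idfun.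
Proof.
have d1 x : 0 <= x <= 1 -> is_derivI idfun x 1.
  move=> x01; apply/is_derivIP => e e0; exists 1 => // y y01 _ /=.
  by rewrite mul1r subrr normr0 mulr_ge0 // ltW.
split=> //.
- by move=> x; rewrite in_itv /= => x01; apply: is_derivI_derivable (d1 x x01).
- apply/contIP => x x01 e e0; exists 1 => // y y01 _.
  rewrite (is_derivI_derivI x01 (d1 x x01)) (is_derivI_derivI y01 (d1 y y01)).
  by rewrite subrr normr0 ltW.
- by move=> x; rewrite in_itv /= => x01; rewrite (is_derivI_derivI x01 (d1 x x01)).
Qed.

Lemma is_derivI_diffC1 f : is_diffC1 f ->
  forall x, 0 <= x <= 1 -> is_derivI f x (derivI f x).
Proof. by move=> fP x x01; apply: (diffC1_derivable fP). Qed.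

Lemma within_cvgI f : {within `[0, 1], continuous f} ->
  forall x, 0 <= x <= 1 -> f y @[y --> within `[0, 1] (nbhs x)] --> f x.
Proof.
by move=> /subspace_continuousP cf x x01; apply: cf; rewrite /= in_itv.
Qed.

Lemma cvg_withinI f :
  (forall x, 0 <= x <= 1 -> f y @[y --> within `[0, 1] (nbhs x)] --> f x) ->
  {within `[0, 1], continuous f}.
Proof.
move=> cf; apply/subspace_continuousP => x xI.
by apply: cf; rewrite /= in_itv in xI.
Qed.

Lemma contI_comp f g x : (forall y, 0 <= y <= 1 -> 0 <= f y <= 1) ->
  contI f x -> contI g (f x) -> contI (g \o f) x.
Proof.
move=> fI cf cg e e0; have [d d0 dP] := cg _ e0.
have [d2 d20 d2P] := cf _ (divr_gt0 d0 (ltr0Sn R 1)).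
exists d2 => // y y01 yx; apply: dP; first exact: fI.
have := d2P y y01 yx; lra.
Qed.

Lemma is_diffC1_comp f g : is_diffC1 f -> is_diffC1 g -> is_diffC1 (f \o g).
Proof.
move=> fP gP; have [fI gI] := (is_diffC1_itv fP, is_diffC1_itv gP).
have dc x : 0 <= x <= 1 ->
    is_derivI (f \o g) x (derivI f (g x) * derivI g x).
  move=> x01; apply: is_derivI_comp => //; first exact: is_derivI_diffC1.
  by apply: is_derivI_diffC1 => //; exact: gI.
have dcE x : 0 <= x <= 1 -> derivI (f \o g) x = derivI f (g x) * derivI g x.
  by move=> x01; apply: is_derivI_derivI (dc x x01).
split.
- split=> [x|x y _ _|x].
  + by rewrite /= !in_itv => x01; exact/fI/gI.
  + by move=> /(is_diffC1_inj fP)/(is_diffC1_inj gP).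
  + case: (diffC1_bij fP) => _ _ fs; case: (diffC1_bij gP) => _ _ gs.
    by move=> /fs[y /gs[z z01 <-] <-]; exists z.
- by rewrite /= (diffC1_at0 gP) (diffC1_at0 fP).
- by rewrite /= (diffC1_at1 gP) (diffC1_at1 fP).
- by move=> x; rewrite in_itv /= => x01; apply: is_derivI_derivable (dc x x01).
- apply: cvg_withinI => x x01; rewrite dcE //.
  apply: (@cvg_trans _ (derivI f (g y) * derivI g y @[y --> within `[0, 1] (nbhs x)])).
    apply: near_eq_cvg; rewrite near_withinE; apply: nearW => y yI.
    by rewrite dcE //; rewrite /= in_itv in yI.
  apply: cvgM; last exact: within_cvgI (diffC1_deriv_cont gP) _ x01.
  apply: (@within_cvgI (derivI f \o g)) => //; apply/contIP => z z01.
  apply: contI_comp => //; first exact: is_derivI_cont (is_derivI_diffC1 gP z01).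
  by apply: (contIP _).1 (diffC1_deriv_cont fP) _ _; exact: gI.
- move=> x; rewrite in_itv /= => x01; rewrite dcE // mulr_gt0 //.
    by apply: (diffC1_deriv_gt0 fP); rewrite in_itv; exact: gI.
  by apply: (diffC1_deriv_gt0 gP); rewrite in_itv.
- by move=> x x01 /=; rewrite (diffC1_out gP) // (diffC1_out fP).
Qed.

Definition inv_fun f y : R := xget 0 [set x | f x = y].

Lemma inv_funK f : is_diffC1 f -> cancel (inv_fun f) f.
Proof.
move=> fP y; have [x fx] := is_diffC1_surj fP y.
exact: (@xgetPex _ 0 [set x | f x = y] (ex_intro _ x fx)).
Qed.

Lemma fun_invK f : is_diffC1 f -> cancel f (inv_fun f).
Proof. by move=> fP x; apply: (is_diffC1_inj fP); rewrite inv_funK. Qed.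

Lemma is_diffC1_inv f : is_diffC1 f -> is_diffC1 (inv_fun f).
Proof.
move=> fP; set g := inv_fun f; have fI := is_diffC1_itv fP.
have [fK gK] : cancel f g /\ cancel g f :=
  conj (fun_invK fP) (inv_funK fP).
have fc : {within `[0, 1], continuous f}.
  by apply/contIP => x x01; apply: is_derivI_cont (is_derivI_diffC1 fP x01).
have out x : x \notin `[0, 1]%R -> g x = x.
  by move=> x01; apply: (is_diffC1_inj fP); rewrite gK (diffC1_out fP).
have gI y : 0 <= y <= 1 -> 0 <= g y <= 1.
  move=> y01; have := diffC1_bij fP => -[_ _ /(_ y)].
  by rewrite /= !in_itv => /(_ y01)[x /=]; rewrite in_itv => x01 <-; rewrite fK.
have gc : {within `[0, 1], continuous g}.
  have := @segment_can_continuous _ 0 1 f g ler01 fc (in1W fK).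
  by rewrite (diffC1_at0 fP) (diffC1_at1 fP) min_l ?max_r.
have dc y : 0 <= y <= 1 -> is_derivI g y (derivI f (g y))^-1.
  move=> y01; have gy := gI y y01; rewrite -{1}(gK y).
  apply: is_derivI_inverse => //; rewrite ?gK //.
  - by apply: (diffC1_deriv_gt0 fP); rewrite in_itv.
  - by have /contIP := gc; apply.
  - exact: is_derivI_diffC1.
have dcE y : 0 <= y <= 1 -> derivI g y = (derivI f (g y))^-1.
  by move=> y01; apply: is_derivI_derivI (dc y y01).
have pos y : 0 <= y <= 1 -> 0 < derivI f (g y).
  by move=> y01; apply: (diffC1_deriv_gt0 fP); rewrite in_itv; exact: gI.
split=> //.
- split=> [x|x y _ _|x].
  + by rewrite /= !in_itv => x01; exact: gI.
  + exact: (can_inj gK).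
  + by rewrite /= !in_itv => x01; exists (f x); rewrite ?fK //= in_itv; exact: fI.
- by apply: (is_diffC1_inj fP); rewrite gK (diffC1_at0 fP).
- by apply: (is_diffC1_inj fP); rewrite gK (diffC1_at1 fP).
- by move=> x; rewrite in_itv /= => x01; apply: is_derivI_derivable (dc x x01).
- apply: cvg_withinI => x x01; rewrite dcE //.
  apply: (@cvg_trans _ ((derivI f (g y))^-1 @[y --> within `[0, 1] (nbhs x)])).
    apply: near_eq_cvg; rewrite near_withinE; apply: nearW => y yI.
    by rewrite dcE //; rewrite /= in_itv in yI.
  apply: cvgV; first by rewrite gt_eqF // pos.
  apply: (@within_cvgI (derivI f \o g)) => //; apply/contIP => z z01.
  apply: contI_comp => //; first by have /contIP := gc; apply.
  by apply: (contIP _).1 (diffC1_deriv_cont fP) _ _; exact: gI.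
- by move=> x; rewrite in_itv /= => x01; rewrite dcE // invr_gt0 pos.
Qed.

Implicit Types F G H : diffC1.

Definition diffC1_one : diffC1 := DiffC1 is_diffC1_id.

Definition diffC1_mul F G : diffC1 :=
  DiffC1 (is_diffC1_comp (diffC1P F) (diffC1P G)).

Definition diffC1_inv F : diffC1 := DiffC1 (is_diffC1_inv (diffC1P F)).

Lemma diffC1_mulA : associative diffC1_mul.
Proof. by move=> F G H; exact: diffC1_ext. Qed.

Lemma diffC1_mul1g : left_id diffC1_one diffC1_mul.
Proof. by move=> F; exact: diffC1_ext. Qed.

Lemma diffC1_mulg1 : right_id diffC1_one diffC1_mul.
Proof. by move=> F; exact: diffC1_ext. Qed.

Lemma diffC1_mulVg : left_inverse diffC1_one diffC1_inv diffC1_mul.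
Proof. by move=> F; apply: diffC1_ext => x /=; exact: fun_invK (diffC1P F) x. Qed.

Lemma diffC1_mulgV : right_inverse diffC1_one diffC1_inv diffC1_mul.
Proof. by move=> F; apply: diffC1_ext => x /=; exact: inv_funK (diffC1P F) x. Qed.

HB.instance Definition _ := isGroup.Build diffC1
  diffC1_mulA diffC1_mul1g diffC1_mulg1 diffC1_mulVg diffC1_mulgV.

Definition distC1 F G : R :=
  sup [set `|derivI F x - derivI G x| | x in `[0, 1]].

Lemma distC1_attained F G : exists c, [/\ 0 <= c <= 1,
  distC1 F G = `|derivI F c - derivI G c| &
  forall x, 0 <= x <= 1 -> `|derivI F x - derivI G x| <= distC1 F G].
Proof.
have [|c c01 cmax] := @EVT_max R (fun x => `|derivI F x - derivI G x|) 0 1 ler01.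
  apply: cvg_withinI => x x01.
  apply: cvg_norm; apply: cvgB; apply: within_cvgI => //.
    exact: diffC1_deriv_cont (diffC1P F).
  exact: diffC1_deriv_cont (diffC1P G).
suff dE : distC1 F G = `|derivI F c - derivI G c|.
  exists c; split=> // x x01.
  by rewrite dE cmax // in_itv.
rewrite /distC1; set S := (X in sup X).
have Sc : S `|derivI F c - derivI G c| by exists c.
have Su : ubound S `|derivI F c - derivI G c| by move=> _ [x x01 <-]; exact: cmax.
apply/eqP; rewrite eq_le; apply/andP; split.
  by apply: ge_sup => //; eexists; exact: Sc.
by apply: ub_le_sup => //; eexists; exact: Su.
Qed.

Lemma distC1_ge F G x : 0 <= x <= 1 ->
  `|derivI F x - derivI G x| <= distC1 F G.
Proof. by move=> x01; have [c [_ _]] := distC1_attained F G; exact. Qed.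

Lemma distC1xx F : distC1 F F = 0.
Proof. by have [c [_ -> _]] := distC1_attained F F; rewrite subrr normr0. Qed.

Lemma distC1_positivity F G : distC1 F G = 0 -> F = G.
Proof.
move=> FG0; apply: diffC1_ext => x.
have [x01|x01] := boolP (x \in `[0, 1]%R); last first.
  by rewrite (diffC1_out (diffC1P F)) // (diffC1_out (diffC1P G)).
apply: derivI_eq => //.
- by rewrite (diffC1_at0 (diffC1P F)) (diffC1_at0 (diffC1P G)).
- exact: (diffC1_derivable (diffC1P F)).
- exact: (diffC1_derivable (diffC1P G)).
- move=> y y01; have := distC1_ge F G y01.
  by rewrite FG0 normr_le0 subr_eq0 => /eqP.
Qed.

Lemma distC1_sym F G : distC1 F G = distC1 G F.
Proof.
by rewrite /distC1; congr sup; apply: eq_imagel => x _; rewrite distrC.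
Qed.

Lemma distC1_triangle G F H : distC1 F H <= distC1 F G + distC1 G H.
Proof.
have [c [c01 -> _]] := distC1_attained F H.
by rewrite (le_trans (ler_distD (derivI G c) _ _)) // lerD // distC1_ge.
Qed.

HB.instance Definition _ := isMetric.Build R diffC1
  distC1xx distC1_positivity distC1_sym distC1_triangle.

End diffeomorphisms.

(* Main.v *)
(* Let A be the closure of the group H generated by the elements T, g, r, E and
   X1, X2, Y1, Y2 described below.

   Compression: there is a sequence h_n -> 1 of diffeomorphisms supported in
   J = [1/4, 1/2] generating a dense subgroup of those supported in J, because
   that group is separable and each F is a product of small steps along
   (1 - t) id + t F. With T x = x / 2 near 0, the infinite product g of the
   T^n h_n T^-n is C^1 and T^-n g T^n = h_n on J. Hence, r being
   supported in J, A contains all conjugates of r by diffeomorphisms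
   supported in J, and therefore all commutators [F, G] with F, G supported in
   an interval L that r displaces from itself.

   Parabolic elements: if F' = 1 at all fixed points of F, then F is conjugate to
   elements close to 1 (the conjugator has derivative the geometric mean of the
   (F^i)', i < n), so F is a limit of commutators [F, G]. Every diffeomorphism
   close to 1 with support inside that of a parabolic bump r0 is a product of the
   two parabolic elements r0 and r0^-1 F. So A contains every diffeomorphism with
   support in a smaller interval.

   Spreading: the generator E, expanding that interval to (0, 1), gives all compactly
   supported diffeomorphisms, whose closure is the set of those tangent to the
   identity at 0 and 1. Finally, X1, X2, Y1, Y2 make the endpoint derivatives
   dense, with log-derivatives ln 2 and sqrt 2 ln 2 at each endpoint. *)

Require Import Defs.
From mathcomp Require Import all_boot all_order all_algebra.
From mathcomp Require Import all_classical all_reals all_analysis.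
From mathcomp Require Import ring lra.

Set Implicit Arguments.
Unset Strict Implicit.
Unset Printing Implicit Defensive.

Import Order.TTheory GRing.Theory Num.Theory.
Import numFieldNormedType.Exports.

Local Open Scope classical_set_scope.
Local Open Scope ring_scope.

(** * Continuity, differentiation and antiderivatives on [0, 1] *)

Section calculus_on_the_unit_interval.
Variable R : realType.
Implicit Types (f g : R -> R) (x y l m e a b : R).

Lemma contI_cst c x : contI (fun=> c) x.
Proof. by move=> e e0; exists 1 => // y _ _; rewrite subrr normr0 ltW. Qed.

Lemma contI_id x : contI id x.
Proof. by move=> e e0; exists e => // y _ /ltW. Qed.

Lemma contI_cvg f x : 0 <= x <= 1 -> contI f x <->
  f y @[y --> within `[0, 1] (nbhs x)] --> f x.
Proof.
move=> x01; split=> [cf|/cvgrPdist_le cf e e0].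
  apply/cvgrPdist_le => e e0; have [d d0 dP] := cf e e0.
  rewrite near_withinE; apply/nbhs_ballP; exists d => //= y; rewrite /ball /=.
  by rewrite in_itv /= distrC => yx y01; rewrite distrC; exact: dP.
have := cf _ e0; rewrite near_withinE; case/nbhs_ballP => d /= d0 dP.
exists d => // y y01 yx.
by rewrite distrC; apply: dP => /=; rewrite ?in_itv // /ball /= distrC.
Qed.

Lemma contID f g x : 0 <= x <= 1 ->
  contI f x -> contI g x -> contI (fun y => f y + g y) x.
Proof. by move=> x01 /contI_cvg cf /contI_cvg cg; apply/contI_cvg => //; apply: cvgD; auto. Qed.

Lemma contIM f g x : 0 <= x <= 1 ->
  contI f x -> contI g x -> contI (fun y => f y * g y) x.
Proof. by move=> x01 /contI_cvg cf /contI_cvg cg; apply/contI_cvg => //; apply: cvgM; auto. Qed.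

Lemma contIN f x : 0 <= x <= 1 -> contI f x -> contI (fun y => - f y) x.
Proof. by move=> x01 /contI_cvg cf; apply/contI_cvg => //; apply: cvgN; auto. Qed.

Lemma contIB f g x : 0 <= x <= 1 ->
  contI f x -> contI g x -> contI (fun y => f y - g y) x.
Proof. by move=> x01 cf cg; apply: contID => //; exact: contIN. Qed.

Lemma contI_sum n (F : nat -> R -> R) x : 0 <= x <= 1 ->
  (forall i, contI (F i) x) -> contI (fun y => \sum_(i < n) F i y) x.
Proof.
move=> x01 cF; elim: n => [|n IHn].
  rewrite (_ : (fun y => _) = fun=> 0); first exact: contI_cst.
  by apply/funext => y; rewrite big_ord0.
rewrite (_ : (fun y => _) = fun y => \sum_(i < n) F i y + F n y); first exact: contID.
by apply/funext => y; rewrite big_ord_recr.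
Qed.

Lemma contI_continuous_comp f g x : 0 <= x <= 1 ->
  contI f x -> {for f x, continuous g} -> contI (g \o f) x.
Proof.
move=> x01 /contI_cvg cf cg; apply/contI_cvg => //.
by apply: (@continuous_cvg _ _ _ _ _ f g (f x)); auto.
Qed.

Lemma contI_norm f x : 0 <= x <= 1 -> contI f x -> contI (fun y => `|f y|) x.
Proof. by move=> x01 cf; apply: contI_continuous_comp cf _ => //; exact: norm_continuous. Qed.

Lemma contI_max f g x : 0 <= x <= 1 ->
  contI f x -> contI g x -> contI (fun y => Num.max (f y) (g y)) x.
Proof.
move=> x01 cf cg.
rewrite (_ : (fun y => _) = fun y => ((f y + g y) + `|f y - g y|) * 2^-1).
  by apply: contIM => //; [apply: contID => //; [exact: contID|
    apply: contI_norm => //; exact: contIB]|exact: contI_cst].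
apply/funext => y; have [fg|fg] := leP (f y) (g y).
  by rewrite ler0_norm ?subr_le0 //; field.
by rewrite gtr0_norm ?subr_gt0 //; field.
Qed.

Lemma contI_eq f g x : 0 <= x <= 1 -> (forall y, 0 <= y <= 1 -> f y = g y) ->
  contI f x -> contI g x.
Proof.
move=> x01 fg cf e e0; have [d d0 dP] := cf e e0; exists d => // y y01 yx.
by rewrite -!fg // dP.
Qed.

(** Heine-Cantor, through the near-covering form of compactness: the ball around each [x] has half
    the radius given by continuity at [x], so that a point [z] of it and any [y] close to [z] are
    both within the full radius. *)
Lemma contI_compact_unif f : (forall x, 0 <= x <= 1 -> contI f x) ->
  forall e, 0 < e -> exists2 d, 0 < d & forall x y, 0 <= x <= 1 -> 0 <= y <= 1 ->
    `|y - x| < d -> `|f y - f x| <= e.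
Proof.
move=> cf e e0; have K := @segment_compact R 0 1.
move/compact_near_coveringP : K => K.
have e2 : 0 < e / 2 by rewrite divr_gt0.
have := K _ (0^'+) (fun d x => 0 <= x <= 1 -> forall y, 0 <= y <= 1 ->
  `|y - x| < d -> `|f y - f x| <= e) _.
case.
  move=> x; rewrite /= in_itv /= => x01; have [d d0 dP] := cf x x01 _ e2.
  exists (ball x (d / 2), [set r | r < d / 2]).
    split; first by apply: nbhsx_ballx; rewrite divr_gt0.
    by apply: nbhs_right_lt; rewrite divr_gt0.
  move=> [z r] /= [zx rd] z01 y y01 yz; rewrite /ball /= in zx.
  have A : `|f z - f x| <= e / 2 by apply: dP => //; rewrite distrC; lra.
  have B : `|f y - f x| <= e / 2.
    apply: dP => //; rewrite (le_lt_trans (ler_distD z _ _)) //.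
    by rewrite [`|z - x|]distrC; lra.
  by rewrite (le_trans (ler_distD (f x) _ _)) // [`|f x - _|]distrC; lra.
move=> d /= d0 dP; exists (d / 2); first by rewrite divr_gt0.
move=> x y x01 y01 yx; apply: (dP (d / 2)) => //=.
- by rewrite sub0r normrN gtr0_norm; lra.
- lra.
Qed.

Lemma contI_within f : (forall x, 0 <= x <= 1 -> contI f x) ->
  {within `[0, 1], continuous f}.
Proof. by move=> ?; apply/contIP. Qed.

Lemma contI_min f : (forall x, 0 <= x <= 1 -> contI f x) ->
  exists2 c, 0 <= c <= 1 & forall x, 0 <= x <= 1 -> f c <= f x.
Proof.
move=> /contI_within /(EVT_min ler01)[c]; rewrite in_itv /= => c01 cP.
by exists c => // x x01; apply: cP; rewrite in_itv.
Qed.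

Lemma contI_bounded f : (forall x, 0 <= x <= 1 -> contI f x) ->
  exists2 M, 0 < M & forall x, 0 <= x <= 1 -> `|f x| <= M.
Proof.
move=> cf; have cN x : 0 <= x <= 1 -> contI (fun y => - `|f y|) x.
  by move=> x01; apply: contIN => //; apply: contI_norm => //; exact: cf.
have [c c01 cP] := contI_min cN.
exists (`|f c| + 1); first by rewrite ltr_wpDl.
by move=> x x01; have := cP x x01; lra.
Qed.

Lemma contI_gt0_min f : (forall x, 0 <= x <= 1 -> contI f x) ->
  (forall x, 0 <= x <= 1 -> 0 < f x) ->
  exists2 m, 0 < m & forall x, 0 <= x <= 1 -> m <= f x.
Proof. by move=> cf f0; have [c c01 cP] := contI_min cf; exists (f c); auto. Qed.

Lemma is_derivI_eq f x l m : l = m -> is_derivI f x l -> is_derivI f x m.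
Proof. by move=> ->. Qed.

Lemma is_derivI_near f g x l d : 0 < d ->
  (forall y, 0 <= y <= 1 -> `|y - x| < d -> f y = g y) -> f x = g x ->
  is_derivI f x l -> is_derivI g x l.
Proof.
move=> d0 fg fgx /is_derivIP fl; apply/is_derivIP => e e0.
have [d' d'0 d'P] := fl e e0; exists (Num.min d d'); first by rewrite lt_min d0.
by move=> y y01; rewrite lt_min => /andP[yd yd']; rewrite -fg // -fgx d'P.
Qed.

Lemma is_derivI_ext f g x l : 0 <= x <= 1 ->
  (forall y, 0 <= y <= 1 -> f y = g y) -> is_derivI f x l -> is_derivI g x l.
Proof. by move=> x01 fg; apply: (@is_derivI_near _ _ _ _ 1) => // *; exact: fg. Qed.

Lemma is_derivI_cst c x : is_derivI (fun=> c) x 0.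
Proof.
apply/is_derivIP => e e0; exists 1 => // y _ _.
by rewrite mul0r subrr subr0 normr0 mulr_ge0 // ltW.
Qed.

Lemma is_derivI_id x : is_derivI id x 1.
Proof.
apply/is_derivIP => e e0; exists 1 => // y _ _.
by rewrite mul1r subrr normr0 mulr_ge0 // ltW.
Qed.

Lemma is_derivID f g x l m : is_derivI f x l -> is_derivI g x m ->
  is_derivI (fun y => f y + g y) x (l + m).
Proof.
move=> fl gm; rewrite /is_derivI.
rewrite (_ : quotI _ _ = fun y => quotI f x y + quotI g x y); first exact: cvgD.
by apply/funext => y; rewrite /quotI -mulrDl; congr (_ / _); ring.
Qed.

Lemma is_derivIZ c f x l : is_derivI f x l -> is_derivI (fun y => c * f y) x (c * l).
Proof.
move=> fl; rewrite /is_derivI.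
rewrite (_ : quotI _ _ = fun y => c * quotI f x y); first exact: cvgMr.
by apply/funext => y; rewrite /quotI -mulrBr mulrA.
Qed.

Lemma is_derivIB f g x l m : is_derivI f x l -> is_derivI g x m ->
  is_derivI (fun y => f y - g y) x (l - m).
Proof.
move=> fl gm; rewrite -[X in _ - X]mul1r -mulNr.
rewrite (_ : (fun y => _) = fun y => f y + (- 1) * g y); last by apply/funext => y; rewrite mulN1r.
by apply: is_derivID => //; exact: is_derivIZ.
Qed.

Lemma is_derivIM f g x l m : 0 <= x <= 1 -> is_derivI f x l -> is_derivI g x m ->
  is_derivI (fun y => f y * g y) x (l * g x + f x * m).
Proof.
move=> x01 fl gm; rewrite /is_derivI.
rewrite (_ : quotI _ _ = fun y => quotI f x y * g y + f x * quotI g x y).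
  apply: cvgD; last exact: cvgMr.
  apply: cvgM => //; have /contI_cvg := is_derivI_cont gm => /(_ x01) cg.
  apply/cvgrPdist_le => e e0; move/cvgrPdist_le : cg => /(_ _ e0).
  by rewrite !near_withinE; apply: filterS => y H ? ?; exact: H.
by apply/funext => y; rewrite /quotI; ring.
Qed.

(** The map u -> max(0, u)^2 has the 2-Lipschitz derivative 2 max(0, u), whence a quadratic Taylor
    remainder. Squared positive parts are what glues explicit formulas in a C^1 way below. *)
Lemma posqr_taylor (u v : R) :
  `|Num.max 0 v ^+ 2 - Num.max 0 u ^+ 2 - 2 * Num.max 0 u * (v - u)| <= (v - u) ^+ 2.
Proof.
rewrite ler_norml.
have [u0|u0] := leP 0 u; have [v0|v0] := leP 0 v.
- by rewrite (_ : v ^+ 2 - _ - _ = (v - u) ^+ 2); [have := sqr_ge0 (v - u); lra|ring].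
- have := sqr_ge0 u; have := mulr_ge0 u0 (ltW (_ : 0 < - v)); rewrite oppr_gt0 => /(_ v0).
  by have := sqr_ge0 v; rewrite !expr2; lra.
- have := sqr_ge0 u; have := mulr_ge0 v0 (ltW (_ : 0 < - u)); rewrite oppr_gt0 => /(_ u0).
  by have := sqr_ge0 v; rewrite !expr2; lra.
- by have := sqr_ge0 (v - u); rewrite !expr2; lra.
Qed.

(** The error is the Taylor remainder, at most (f y - f x)^2 and hence of derivative 0 at [x], plus
    the error of the linear part. *)
Lemma is_derivI_posqr f x l : 0 <= x <= 1 -> is_derivI f x l ->
  is_derivI (fun y => Num.max 0 (f y) ^+ 2) x (2 * Num.max 0 (f x) * l).
Proof.
move=> x01 fl; set M := fun y => Num.max 0 (f y).
have sq : is_derivI (fun y => (f y - f x) ^+ 2) x 0.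
  rewrite (_ : (fun y => _) = (fun y => (f y - f x) * (f y - f x))).
    have H := is_derivIB fl (is_derivI_cst (f x) x).
    by apply: is_derivI_eq (is_derivIM x01 H H); rewrite subrr; ring.
  by apply/funext => y; rewrite expr2.
have lin : is_derivI (fun y => 2 * M x * f y) x (2 * M x * l) by exact: is_derivIZ.
apply/is_derivIP => e e0; have e2 : 0 < e / 2 by rewrite divr_gt0.
have /is_derivIP /(_ _ e2)[d1 d10 d1P] := sq.
have /is_derivIP /(_ _ e2)[d2 d20 d2P] := lin.
exists (Num.min d1 d2); first by rewrite lt_min d10.
move=> y y01; rewrite lt_min => /andP[yd1 yd2].
have {}d1P := d1P y y01 yd1; have {}d2P := d2P y y01 yd2.
rewrite subrr expr0n /= subr0 mul0r subr0 in d1P.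
rewrite (_ : _ - _ = (M y ^+ 2 - M x ^+ 2 - 2 * M x * (f y - f x)) +
  (2 * M x * f y - 2 * M x * f x - 2 * M x * l * (y - x))); last by rewrite -/(M y) -/(M x); ring.
apply: (le_trans (ler_normD _ _)); rewrite [in leRHS](splitr e) [leRHS]mulrDl lerD //.
apply: le_trans d1P; rewrite (ger0_norm (sqr_ge0 _)) /M.
exact: posqr_taylor.
Qed.

Lemma is_derivI_MVT f (df : R -> R) a b : 0 <= a -> a < b -> b <= 1 ->
  (forall x, a <= x <= b -> is_derivI f x (df x)) ->
  exists2 c, a < c < b & f b - f a = df c * (b - a).
Proof.
move=> a0 ab b1 fdf; have [||c] := @MVT R f df a b ab _ _.
- move=> x; rewrite in_itv /= => xab; apply: is_derivI_is_derive; [lra|apply: fdf; lra].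
- apply/subspace_continuousP => x /=; rewrite in_itv /= => xab.
  apply/cvgrPdist_le => e e0; have [d d0 dP] := is_derivI_cont (fdf x xab) e0.
  rewrite near_withinE; apply/nbhs_ballP; exists d => //= y; rewrite /ball /= distrC.
  by rewrite in_itv /= => yx yab; rewrite distrC; apply: dP => //; lra.
- by rewrite in_itv /= => cab ->; exists c.
Qed.

Lemma is_derivI_homo f (df : R -> R) a b : 0 <= a -> b <= 1 ->
  (forall x, a <= x <= b -> is_derivI f x (df x)) ->
  (forall x, a <= x <= b -> 0 < df x) ->
  forall x y, a <= x -> x < y -> y <= b -> f x < f y.
Proof.
move=> a0 b1 fdf df0 x y ax xy yb.
have [|||c cxy] := @is_derivI_MVT f df x y _ xy; try lra.
  by move=> z zxy; apply: fdf; lra.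
move=> E; rewrite -subr_gt0 E mulr_gt0 ?subr_gt0 //; apply: df0; lra.
Qed.

Lemma is_derivI_homo_le f (df : R -> R) a b : 0 <= a -> b <= 1 ->
  (forall x, a <= x <= b -> is_derivI f x (df x)) ->
  (forall x, a <= x <= b -> 0 <= df x) ->
  forall x y, a <= x -> x <= y -> y <= b -> f x <= f y.
Proof.
move=> a0 b1 fdf df0 x y ax; rewrite le_eqVlt => /predU1P[->//|xy] yb.
have [|||c cxy] := @is_derivI_MVT f df x y _ xy; try lra.
  by move=> z zxy; apply: fdf; lra.
move=> E; rewrite -subr_ge0 E mulr_ge0 ?subr_ge0 ?(ltW xy) //; apply: df0; lra.
Qed.

Lemma is_derivI_lipschitz f (df : R -> R) a b e : 0 <= a -> b <= 1 ->
  (forall x, a <= x <= b -> is_derivI f x (df x)) ->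
  (forall x, a <= x <= b -> `|df x| <= e) ->
  forall x y, a <= x <= b -> a <= y <= b -> `|f y - f x| <= e * `|y - x|.
Proof.
move=> a0 b1 fdf dfe x y.
wlog xy : x y / x < y.
  move=> H; have [xy|yx|->] := ltgtP x y; first exact: H.
    by move=> xab yab; rewrite distrC [`|y - x|]distrC; exact: H.
  by rewrite !subrr !normr0 mulr0.
move=> xab yab; have [|||c cxy ->] := @is_derivI_MVT f df x y _ xy; try lra.
  by move=> z zxy; apply: fdf; lra.
by rewrite normrM ler_wpM2r // dfe //; lra.
Qed.

(** Agreement on one side of [x] suffices, since a one-sided difference quotient already determines
    the derivative. This gives derivatives at the edge of a support. *)
Lemma is_derivI_unique_on f g x l m a b : 0 <= a -> b <= 1 -> a < b -> a <= x <= b ->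
  (forall y, a <= y <= b -> f y = g y) ->
  is_derivI f x l -> is_derivI g x m -> l = m.
Proof.
move=> a0 b1 ab xab fg /is_derivIP fl /is_derivIP gm; apply/eqP/contraT => lm.
have e0 : 0 < `|l - m| / 4 by rewrite divr_gt0 // normr_gt0 subr_eq0.
have [d1 d10 d1P] := fl _ e0; have [d2 d20 d2P] := gm _ e0.
pose d := Num.min d1 d2; have d0 : 0 < d by rewrite lt_min d10.
suff [y [yab yx yd]] : exists y, [/\ a <= y <= b, y != x & `|y - x| < d].
  have y01 : 0 <= y <= 1 by lra.
  move: yd; rewrite lt_min => /andP[yd1 yd2].
  have {d1P}A := d1P y y01 yd1; have {d2P}B := d2P y y01 yd2.
  rewrite !fg // in A.
  have y0 : 0 < `|y - x| by rewrite normr_gt0 subr_eq0.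
  have : `|l - m| * `|y - x| <= (`|l - m| / 4 + `|l - m| / 4) * `|y - x|.
    rewrite -normrM [leRHS]mulrDl.
    rewrite (_ : (l - m) * _ = (g y - g x - m * (y - x)) - (g y - g x - l * (y - x))); last by ring.
    by rewrite (le_trans (ler_normB _ _)) // lerD.
  rewrite ler_pM2r //; lra.
pose h := Num.min (d / 2) ((b - a) / 2).
have h0 : 0 < h by rewrite lt_min !divr_gt0 // subr_gt0.
have hd : h <= d / 2 by rewrite ge_min lexx.
have hb : h <= (b - a) / 2 by rewrite ge_min lexx orbT.
(* The step [h] is at most half the length, so moving away from the nearer endpoint stays in
   [a, b]. *)
have [xl|xl] := lerP x ((a + b) / 2).
  exists (x + h); split; [lra| |].
    by rewrite -subr_eq0 addrAC subrr add0r gt_eqF.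
  by rewrite addrAC subrr add0r gtr0_norm //; lra.
exists (x - h); split; [lra| |].
  by rewrite -subr_eq0 addrAC subrr add0r oppr_eq0 gt_eqF.
by rewrite addrAC subrr add0r normrN gtr0_norm //; lra.
Qed.

(** Clamping the argument to [0, 1] extends [p] continuously to the line; integrating the extension
    from -1 makes 0 and 1 interior points, where the fundamental theorem gives a two-sided
    derivative. *)
Lemma continuous_antiderivative (p : R -> R) : (forall x, 0 <= x <= 1 -> contI p x) ->
  exists f, f 0 = 0 /\ forall x, 0 <= x <= 1 -> is_derivI f x (p x).
Proof.
move=> cp; pose k (x : R) := Num.max 0 (Num.min 1 x).
have k01 x : 0 <= k x <= 1.
  by rewrite /k le_max lexx ge_max ler01 ge_min lexx.
have kE x : 0 <= x <= 1 -> k x = x.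
  by move=> /andP[x0 x1]; rewrite /k min_r // max_r.
have klip x y : `|k y - k x| <= `|y - x|.
  rewrite /k; have [y1|y1] := leP 1 y; have [x1|x1] := leP 1 x;
  rewrite ?(max_r ler01); have [y0|y0] := leP 0 y; have [x0|x0] := leP 0 x;
  have := ler_norm (y - x); have := ler_norm (x - y); rewrite [`|x - y|]distrC;
  rewrite ler_norml => ? ?; apply/andP; split; lra.
pose q := p \o k.
have cq : continuous q.
  move=> x; apply/cvgrPdist_le => e e0; have [d d0 dP] := cp _ (k01 x) e e0.
  apply/nbhs_ballP; exists d => //= y; rewrite /ball /= distrC => yx.
  by rewrite distrC; apply: dP => //; rewrite (le_lt_trans (klip _ _)).
pose mu := @lebesgue_measure R.
pose F x := (\int[mu]_(t in `[(-1)%R, x]) (q t))%R.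
have dF x : 0 <= x <= 1 -> is_derive x 1 F (p x).
  move=> x01; have [|||dF] := @continuous_FTC1_closed R q (-1) x 2 _ _ _ (cq x); try lra.
  - apply: continuous_compact_integrable; first exact: segment_compact.
    exact: continuous_subspaceT.
  - by move=> E; apply: DeriveDef => //; rewrite -derive1E E /q /= kE.
exists (fun x => F x - F 0); split; first by rewrite subrr.
move=> x x01; apply/is_derivIP => e e0; have [dFx Fx] := dF x x01.
move: (dFx : cvg _) => /cvgP; move: Fx; rewrite /derive => -> /cvgrPdist_le /(_ _ e0).
rewrite /dnbhs near_withinE => /nbhs_ballP[d /= d0 dP]; exists d => // y y01 yx.
have [->|nyx] := eqVneq y x; first by rewrite !subrr mulr0 subr0 normr0 mulr0.
have yx0 : y - x != 0 by rewrite subr_eq0.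
have := dP (y - x); rewrite /ball /= sub0r normrN => /(_ yx yx0).
rewrite /GRing.scale /= mulr1 subrK distrC => H.
rewrite (_ : _ - _ - _ = ((y - x)^-1 * (F y - F x) - p x) * (y - x)); last by field.
by rewrite normrM ler_wpM2r.
Qed.
End calculus_on_the_unit_interval.

(** * The topological group of C^1 diffeomorphisms, and supports *)

Section interval_diffeomorphisms.
Variable R : realType.
Implicit Types (F G K : diffC1 R) (x y a b e : R).

Lemma diffC1_0 F : F 0 = 0. Proof. exact: diffC1_at0 (diffC1P F). Qed.
Lemma diffC1_1 F : F 1 = 1. Proof. exact: diffC1_at1 (diffC1P F). Qed.

Lemma diff_itv F x : 0 <= x <= 1 -> 0 <= F x <= 1.
Proof. exact: is_diffC1_itv (diffC1P F) x. Qed.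

Lemma diff_out F x : ~~ (0 <= x <= 1) -> F x = x.
Proof. by move=> x01; rewrite (diffC1_out (diffC1P F)) // in_itv. Qed.

Lemma diff_is_derivI F x : 0 <= x <= 1 -> is_derivI F x (derivI F x).
Proof. by move=> x01; apply: is_derivI_diffC1 (diffC1P F) x x01. Qed.

Lemma diff_deriv_gt0 F x : 0 <= x <= 1 -> 0 < derivI F x.
Proof. by move=> x01; apply: (diffC1_deriv_gt0 (diffC1P F)); rewrite in_itv. Qed.

Lemma diff_deriv_cont F x : 0 <= x <= 1 -> contI (derivI F) x.
Proof. by move: x; apply/contIP; exact: diffC1_deriv_cont (diffC1P F). Qed.

Lemma diff_cont F x : 0 <= x <= 1 -> contI F x.
Proof. by move=> x01; exact: is_derivI_cont (diff_is_derivI x01). Qed.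

Lemma diff_lt F : {homo F : x y / x < y}.
Proof.
move=> x y xy; have [x01|x01] := boolP (0 <= x <= 1);
  have [y01|y01] := boolP (0 <= y <= 1).
- apply: (@is_derivI_homo _ F (derivI F) 0 1) => //; try lra.
    by move=> z; exact: diff_is_derivI.
  by move=> z; exact: diff_deriv_gt0.
- rewrite [F y]diff_out //; have /andP[_ Fx] := diff_itv F x01.
  by apply: le_lt_trans Fx _; rewrite ltNge; apply: contra y01 => y1; lra.
- rewrite [F x]diff_out //; have /andP[Fy _] := diff_itv F y01.
  by apply: lt_le_trans Fy; rewrite ltNge; apply: contra x01 => x0; lra.
- by rewrite !diff_out.
Qed.

Lemma diff_le F : {mono F : x y / x <= y}.
Proof. exact/le_mono/diff_lt. Qed.

Lemma diff_inj F : injective F.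
Proof. exact: is_diffC1_inj (diffC1P F). Qed.

Lemma diffC1_1E x : (1%g : diffC1 R) x = x. Proof. by []. Qed.
Lemma diffC1M F G x : (F * G)%g x = F (G x). Proof. by []. Qed.
Lemma diffC1K F x : (F^-1)%g (F x) = x.
Proof. exact: fun_invK (diffC1P F) x. Qed.
Lemma diffC1VK F x : F ((F^-1)%g x) = x.
Proof. exact: Defs.inv_funK (diffC1P F) x. Qed.

Lemma diffC1_surj F y : exists x, F x = y.
Proof. by exists (F^-1%g y); rewrite diffC1VK. Qed.

Lemma diff_itvE F x : (0 <= F x <= 1) = (0 <= x <= 1).
Proof.
have A : (0 <= F x) = (0 <= x) by rewrite -{1}(diffC1_0 F) diff_le.
have B : (F x <= 1) = (x <= 1) by rewrite -{1}(diffC1_1 F) diff_le.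
by rewrite A B.
Qed.

Lemma deriv_one x : 0 <= x <= 1 -> derivI (1%g : diffC1 R) x = 1.
Proof. by move=> x01; apply: is_derivI_derivI => //; exact: is_derivI_id. Qed.

Lemma deriv_mulg F G x : 0 <= x <= 1 ->
  derivI (F * G)%g x = derivI F (G x) * derivI G x.
Proof.
move=> x01; apply: is_derivI_derivI => //.
apply: is_derivI_comp => [y||]; [exact: diff_itv|exact: diff_is_derivI|].
by apply: diff_is_derivI; exact: diff_itv.
Qed.

Lemma deriv_invg F x : 0 <= x <= 1 -> derivI (F^-1)%g (F x) = (derivI F x)^-1.
Proof.
move=> x01; have := deriv_mulg F^-1%g F x01; rewrite mulVg deriv_one //.
by move=> E; rewrite -[LHS](@mulfK _ (derivI F x)) ?gt_eqF ?diff_deriv_gt0 // -E mul1r.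
Qed.

Lemma diff_deriv_bounded F :
  exists2 M, 0 < M & forall x, 0 <= x <= 1 -> derivI F x <= M.
Proof.
have [M M0 MP] := contI_bounded (@diff_deriv_cont F); exists M => // x x01.
exact: le_trans (ler_norm _) (MP x x01).
Qed.

(** All explicit diffeomorphisms below are built here: a positive derivative gives injectivity, the
    intermediate value theorem surjectivity. Outside [0, 1] the values of [f] are replaced by the
    identity, as the representation demands. *)
Lemma diff_of_derivative (f df : R -> R) : f 0 = 0 -> f 1 = 1 ->
  (forall x, 0 <= x <= 1 -> is_derivI f x (df x)) ->
  (forall x, 0 <= x <= 1 -> contI df x) ->
  (forall x, 0 <= x <= 1 -> 0 < df x) ->
  exists F : diffC1 R, forall x, 0 <= x <= 1 -> F x = f x /\ derivI F x = df x.
Proof.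
move=> f0 f1 fdf cdf df0.
pose F x := if 0 <= x <= 1 then f x else x.
have FE x : 0 <= x <= 1 -> F x = f x by rewrite /F => ->.
have FdF x : 0 <= x <= 1 -> is_derivI F x (df x).
  move=> x01; apply: is_derivI_ext (fdf x x01) => // y y01; by rewrite FE.
have dFE x : 0 <= x <= 1 -> derivI F x = df x.
  by move=> x01; exact: is_derivI_derivI x01 (FdF x x01).
have flt x y : 0 <= x -> x < y -> y <= 1 -> f x < f y.
  by apply: (@is_derivI_homo _ f df 0 1).
have fle x y : 0 <= x -> x <= y -> y <= 1 -> f x <= f y.
  by move=> x0; rewrite le_eqVlt => /predU1P[->//|xy] y1; rewrite ltW // flt.
have FP : is_diffC1 F.
  split.
  - split=> [x|x y /set_mem + /set_mem|x]; rewrite /= !in_itv /=.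
    + move=> x01; rewrite FE // -f0 -f1; move/andP: x01 => [x0 x1].
      by rewrite !fle.
    + move=> x01 y01; rewrite !FE // => fxy; have [xy|yx|//] := ltgtP x y.
        by have := @flt x y; rewrite fxy ltxx; lra.
      by have := @flt y x; rewrite fxy ltxx; lra.
    + move=> x01; have [||c] := @IVT R f 0 1 x ler01.
      * by apply/contIP => y y01; exact: is_derivI_cont (fdf y y01).
      * by rewrite f0 f1 min_l ?max_r.
      * by rewrite in_itv /= => c01 <-; exists c; rewrite /= ?in_itv ?FE.
  - by rewrite FE ?lexx ?ler01.
  - by rewrite FE ?lexx ?ler01.
  - by move=> x; rewrite in_itv /= => x01; exact: is_derivI_derivable (FdF x x01).
  - apply: contI_within => x x01; apply: contI_eq (cdf x x01) => // y y01.
    by rewrite dFE.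
  - by move=> x; rewrite in_itv /= => x01; rewrite dFE // df0.
  - by move=> x; rewrite in_itv /= /F => /negbTE ->.
by exists (DiffC1 FP) => x x01; split; [exact: FE|exact: dFE].
Qed.

Lemma distC1_le F G e :
  (forall x, 0 <= x <= 1 -> `|derivI F x - derivI G x| <= e) -> distC1 F G <= e.
Proof. by move=> FG; have [c [c01 -> _]] := distC1_attained F G; exact: FG. Qed.

Lemma distC1_ge0 F G : 0 <= distC1 F G.
Proof. by have [c [c01 -> _]] := distC1_attained F G. Qed.

(** Mean value inequality for F - G, which vanishes at 0: C^1 distance controls displacement. *)
Lemma le_distC1 F G x : 0 <= x <= 1 -> `|F x - G x| <= distC1 F G * x.
Proof.
move=> x01; have := @is_derivI_lipschitz _ (fun y => F y - G y)
  (fun y => derivI F y - derivI G y) 0 1 (distC1 F G) (lexx _) (lexx _) _ _ 0 x.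
rewrite !diffC1_0 !subr0 (ger0_norm (proj1 (andP x01))); apply; rewrite ?lexx ?ler01 //.
  by move=> y y01; apply: is_derivIB; exact: diff_is_derivI.
by move=> y y01; exact: distC1_ge.
Qed.

Lemma distC1_mulr F G K M : (forall x, 0 <= x <= 1 -> derivI K x <= M) ->
  distC1 (F * K)%g (G * K)%g <= distC1 F G * M.
Proof.
move=> KM; apply: distC1_le => x x01; rewrite !deriv_mulg // -mulrBl normrM.
rewrite [`|derivI K x|]gtr0_norm ?diff_deriv_gt0 //.
by rewrite ler_pM ?KM // ?(ltW (diff_deriv_gt0 _ _)) // distC1_ge // diff_itv.
Qed.

(** Derivatives of [F] are compared at the different points [G x] and [K x], so the bound rests on
    the uniform continuity of F' and not only on its size. *)
Lemma mulg_continuous_r F G e : 0 < e ->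
  exists2 d, 0 < d & forall K, distC1 G K <= d -> distC1 (F * G)%g (F * K)%g <= e.
Proof.
move=> e0; have [MF MF0 MFP] := diff_deriv_bounded F.
have [MG MG0 MGP] := diff_deriv_bounded G.
have e1 : 0 < e / 2 / MG by rewrite !divr_gt0.
have [d d0 dP] := contI_compact_unif (@diff_deriv_cont F) e1.
exists (Num.min (d / 2) (e / 2 / MF)); first by rewrite lt_min !divr_gt0.
move=> K; rewrite le_min => /andP[GKd GKe]; apply: distC1_le => x x01.
have [Gx Kx] := (diff_itv G x01, diff_itv K x01).
rewrite !deriv_mulg //.
rewrite (_ : _ - _ = (derivI F (G x) - derivI F (K x)) * derivI G x +
  derivI F (K x) * (derivI G x - derivI K x)); last by ring.
rewrite (le_trans (ler_normD _ _)) // [leRHS](splitr e) lerD // normrM.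
  rewrite [`|derivI G x|]gtr0_norm ?diff_deriv_gt0 //.
  apply: (@le_trans _ _ (e / 2 / MG * MG)); last by rewrite divfK // gt_eqF.
  rewrite ler_pM ?MGP // ?(ltW (diff_deriv_gt0 _ _)) // dP //.
  rewrite (le_lt_trans (le_distC1 G K x01)) //.
  apply: (@le_lt_trans _ _ (distC1 G K)); last lra.
  by rewrite ler_piMr ?distC1_ge0 //; lra.
rewrite [`|derivI F _|]gtr0_norm ?diff_deriv_gt0 //.
apply: (@le_trans _ _ (MF * (e / 2 / MF))); last by rewrite mulrC divfK // gt_eqF.
by rewrite ler_pM ?MFP // ?(ltW (diff_deriv_gt0 _ _)) // (le_trans _ GKe) // distC1_ge.
Qed.

(** For u = F' at the preimage, |1/u - 1| = |1 - u| / u, and u is at least 1/2. *)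
Lemma distC1_inv1 F e : e <= 1 / 2 -> distC1 F 1%g <= e -> distC1 (F^-1)%g 1%g <= 2 * e.
Proof.
move=> e1 Fe; apply: distC1_le => y; rewrite -(diffC1VK F y) (diff_itvE F).
set x := (F^-1)%g y => x01; rewrite deriv_invg // deriv_one ?(diff_itvE F) //.
have := le_trans (distC1_ge F 1%g x01) Fe; rewrite deriv_one // => Fx.
have F0 := diff_deriv_gt0 F x01; set u := derivI F x in Fx F0 *.
rewrite (_ : u^-1 - 1 = u^-1 * (1 - u)); last by field; rewrite gt_eqF.
rewrite normrM distrC gtr0_norm ?invr_gt0 // mulrC ler_pdivrMr //.
rewrite (le_trans Fx) //; move: Fx; rewrite ler_norml; nra.
Qed.

Lemma closure_distC1 (A : set (diffC1 R)) F : closure A F <->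
  forall e, 0 < e -> exists2 G, A G & distC1 F G <= e.
Proof.
split=> [AF e e0|AF B].
  have [|G [AG FG]] := AF (ball F e); first exact: nbhsx_ballx.
  by exists G => //; exact: ltW FG.
move=> /nbhs_ballP[e /= e0 eB]; have [G AG FG] := AF _ (divr_gt0 e0 (ltr0Sn R 1)).
exists G; split => //; apply: eB; rewrite /ball /=.
by apply: le_lt_trans FG _; lra.
Qed.

Lemma mulg_continuous F G e : 0 < e -> exists2 d, 0 < d & forall F1 G1,
  distC1 F F1 <= d -> distC1 G G1 <= d -> distC1 (F * G)%g (F1 * G1)%g <= e.
Proof.
move=> e0; have e2 : 0 < e / 2 by rewrite divr_gt0.
have [d d0 dP] := mulg_continuous_r F G e2; have [M M0 MP] := diff_deriv_bounded G.
have M1 : 0 < M + 1 by rewrite addr_gt0.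
(* The bound 1 gives G1' at most [M + 1], needed for right translation by [G1]; the triangle
   inequality goes through [F * G1]. *)
exists (Num.min 1 (Num.min d (e / 2 / (M + 1)))).
  by rewrite !lt_min ltr01 d0 divr_gt0.
move=> F1 G1; rewrite !le_min => /andP[_ /andP[_ FF1]] /andP[GG1 /andP[GG1d _]].
have MP1 x : 0 <= x <= 1 -> derivI G1 x <= M + 1.
  move=> x01; have := MP x x01; have := le_trans (distC1_ge G G1 x01) GG1.
  by rewrite ler_norml => ? ?; lra.
rewrite (le_trans (distC1_triangle (F * G1)%g _ _)) // [leRHS]splitr lerD ?dP //.
by rewrite (le_trans (distC1_mulr _ _ MP1)) // -ler_pdivlMr.
Qed.

(** Reduction to the identity: F^-1 F1 is close to 1, hence so is its inverse F1^-1 F, and right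
    translation by F^-1 is Lipschitz. *)
Lemma invg_continuous F e : 0 < e -> exists2 d, 0 < d & forall F1,
  distC1 F F1 <= d -> distC1 F^-1%g F1^-1%g <= e.
Proof.
move=> e0; have [M M0 MP] := diff_deriv_bounded F^-1%g.
pose e1 := Num.min (1 / 2) (e / M / 2).
have e10 : 0 < e1 by rewrite lt_min !divr_gt0.
have [d d0 dP] := mulg_continuous_r F^-1%g F e10; exists d => // F1 FF1.
have := dP _ FF1; rewrite mulVg distC1_sym => /distC1_inv1.
rewrite ge_min lexx => /(_ isT); rewrite invgM invgK => H.
rewrite distC1_sym (_ : F1^-1 = F1^-1 * F * F^-1)%g; last by rewrite mulgK.
rewrite -[X in distC1 _ X]mul1g (le_trans (distC1_mulr _ _ MP)) //.
rewrite -ler_pdivlMr // (le_trans H) //.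
have : e1 <= e / M / 2 by rewrite ge_min lexx orbT.
lra.
Qed.

Lemma is_subgroup_closure (A : set (diffC1 R)) : is_subgroup A -> is_subgroup (closure A).
Proof.
move=> /is_subgroupP[A1 AM AV]; apply/is_subgroupP; split=> [|F G|F].
- exact: subset_closure.
- move=> /closure_distC1 AF /closure_distC1 AG; apply/closure_distC1 => e e0.
  have [d d0 dP] := mulg_continuous F G e0.
  have [F1 AF1 FF1] := AF d d0; have [G1 AG1 GG1] := AG d d0.
  by exists (F1 * G1)%g; [exact: AM|exact: dP].
- move=> /closure_distC1 AF; apply/closure_distC1 => e e0.
  have [d d0 dP] := invg_continuous F e0; have [F1 AF1 FF1] := AF d d0.
  by exists F1^-1%g; [exact: AV|exact: dP].
Qed.

Lemma conjg_continuous F G e : 0 < e -> exists2 d, 0 < d & forall F1,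
  distC1 F F1 <= d -> distC1 (F * G * F^-1)%g (F1 * G * F1^-1)%g <= e.
Proof.
move=> e0; have [d d0 dP] := mulg_continuous (F * G)%g F^-1%g e0.
have [d1 d10 d1P] := mulg_continuous F G d0.
have [d2 d20 d2P] := invg_continuous F d0.
exists (Num.min d1 d2); first by rewrite lt_min d10.
move=> F1; rewrite le_min => /andP[H1 H2]; apply: dP; last exact: d2P.
by apply: d1P => //; rewrite distC1xx ltW.
Qed.

Definition supported a b F := forall x, (x <= a -> F x = x) /\ (b <= x -> F x = x).

Lemma supportedW a b a' b' F : a' <= a -> b <= b' -> supported a b F -> supported a' b' F.
Proof. by move=> aa bb Fs x; split=> xa; [apply: (Fs x).1|apply: (Fs x).2]; lra. Qed.

Lemma supported1 a b : supported a b 1%g. Proof. by move=> x. Qed.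

Lemma supportedM a b F G : supported a b F -> supported a b G -> supported a b (F * G)%g.
Proof.
move=> Fs Gs x; split=> xa; rewrite diffC1M; first by rewrite (Gs x).1 // (Fs x).1.
by rewrite (Gs x).2 // (Fs x).2.
Qed.

Lemma supportedV a b F : supported a b F -> supported a b F^-1%g.
Proof.
by move=> Fs x; split=> xa; apply: (@diff_inj F); rewrite diffC1VK;
  [rewrite (Fs x).1|rewrite (Fs x).2].
Qed.

Lemma supported_closed a b : closure (supported a b) `<=` supported a b.
Proof.
move=> F /closure_distC1 cF x.
have H G : supported a b G -> x <= a \/ b <= x -> G x = x by move=> Gs [/(Gs x).1|/(Gs x).2].
suff E : x <= a \/ b <= x -> F x = x by split=> xab; apply: E; [left|right].
move=> xab; have [x01|x01] := boolP (0 <= x <= 1); last by rewrite diff_out.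
apply/eqP; rewrite -subr_eq0 -normr_le0; apply/ler_addgt0Pl => e e0; rewrite addr0.
have [G Gs FG] := cF e e0; rewrite -{2}(H G Gs xab).
apply: le_trans (le_distC1 F G x01) _; apply: le_trans FG.
by rewrite ler_piMr ?distC1_ge0 //; case/andP: x01.
Qed.

(** The point [b] is fixed by both maps, so each preserves the two sides of it; on each side one of
    them is the identity. *)
Lemma supported_commute a b c d F G : b <= c -> supported a b F -> supported c d G ->
  (F * G = G * F)%g.
Proof.
move=> bc Fs Gs; apply: diffC1_ext => x; rewrite !diffC1M.
have Fb : F b = b by exact: (Fs b).2.
have Gb : G b = b by exact: (Gs b).1.
have [xb|bx] := leP x b.
  have Fx : F x <= b by rewrite -Fb diff_le.
  by rewrite (Gs x).1 ?(le_trans xb) // (Gs (F x)).1 // (le_trans Fx).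
have Gx : b <= G x by rewrite -Gb diff_le ltW.
by rewrite (Fs x).2 ?ltW // (Fs (G x)).2.
Qed.

Lemma supportedJ a b F G : supported a b F -> supported (G a) (G b) (G * F * G^-1)%g.
Proof.
move=> Fs x; rewrite !diffC1M; split=> xa.
  by rewrite (Fs _).1 ?diffC1VK // -(diff_le G) diffC1VK.
by rewrite (Fs _).2 ?diffC1VK // -(diff_le G) diffC1VK.
Qed.

Lemma supported_itv a b F x : supported a b F -> a <= b -> (a <= F x <= b) = (a <= x <= b).
Proof.
move=> Fs ab; have A : (a <= F x) = (a <= x) by rewrite -{1}((Fs a).1 (lexx a)) diff_le.
have B : (F x <= b) = (x <= b) by rewrite -{1}((Fs b).2 (lexx b)) diff_le.
by rewrite A B.
Qed.

(** The edges [a] and [b] are included: there [F] is the identity on one side, and 0 < a, b < 1 make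
    that side a nondegenerate interval. *)
Lemma supported_deriv a b F x : 0 < a -> b < 1 -> supported a b F ->
  0 <= x <= 1 -> x <= a \/ b <= x -> derivI F x = 1.
Proof.
move=> a0 b1 Fs x01 [xa|bx].
  apply: (@is_derivI_unique_on _ F id x _ _ 0 (Num.min a 1)); rewrite ?ge_min ?lexx ?orbT //.
  - by rewrite lt_min a0 /=.
  - by rewrite le_min xa; lra.
  - by move=> y; rewrite le_min => /andP[y0 /andP[ya _]]; apply: (Fs y).1.
  - exact: diff_is_derivI.
  - exact: is_derivI_id.
apply: (@is_derivI_unique_on _ F id x _ _ (Num.max 0 b) 1); rewrite ?le_max ?lexx //.
- by rewrite gt_max b1 andbT.
- by rewrite ge_max bx; lra.
- by move=> y; rewrite ge_max => /andP[/andP[_ yb] _]; apply: (Fs y).2.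
- exact: diff_is_derivI.
- exact: is_derivI_id.
Qed.
End interval_diffeomorphisms.

(** * Parabolic diffeomorphisms as limits of commutators *)

Section parabolic_diffeomorphisms.
Variable R : realType.
Implicit Types (F G K : diffC1 R) (x y a b e : R) (n i : nat).

(** Each [u i] lies above the tangent to exp at the mean logarithm [m], evaluated at ln (u i); the
    linear terms cancel on averaging. *)
Lemma AMGM_expR n (u : nat -> R) : (0 < n)%N -> (forall i, 0 < u i) ->
  expR (n%:R^-1 * \sum_(i < n) ln (u i)) <= n%:R^-1 * \sum_(i < n) u i.
Proof.
move=> n0 u0; set m := _ * \sum_(i < n) ln _; have nR : (0 : R) < n%:R by rewrite ltr0n.
have H i : (1 + (ln (u i) - m)) * expR m <= u i.
  apply: (@le_trans _ _ (expR (ln (u i) - m) * expR m)).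
    by rewrite ler_pM2r ?expR_gt0 // expR_ge1Dx.
  by rewrite -expRD subrK lnK // posrE.
rewrite mulrC ler_pdivlMr // mulrC.
apply: le_trans (ler_sum _ (fun (i : 'I_n) _ => H i)); rewrite -mulr_suml.
rewrite ler_pM2r ?expR_gt0 // big_split /= sumr_const card_ord lerDl.
by rewrite sumrB sumr_const card_ord -mulr_natr /m mulrAC mulVf ?gt_eqF // mul1r subrr.
Qed.

(** The normalised integral of max(0, (x - a)(b - x)). Adding a multiple of it to a primitive
    restores the value at 1 while changing the derivative only inside [a, b]. *)
Lemma bump_step a b : 0 <= a -> a < b -> b <= 1 -> exists B db : R -> R,
  [/\ B 0 = 0, B 1 = 1, forall x, 0 <= x <= 1 -> is_derivI B x (db x),
      forall x, 0 <= x <= 1 -> contI db x &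
      (forall x, 0 <= db x) /\ forall x, x <= a \/ b <= x -> db x = 0].
Proof.
move=> a0 ab b1; pose h (x : R) := Num.max 0 ((x - a) * (b - x)).
have ch x : 0 <= x <= 1 -> contI h x.
  move=> x01; apply: contI_max => //; first exact: contI_cst.
  by apply: contIM => //; apply: contIB => //; solve [exact: contI_cst|exact: contI_id].
have h0 x : 0 <= h x by rewrite le_max lexx.
have hout x : x <= a \/ b <= x -> h x = 0.
  by move=> xab; apply: max_l; case: xab => xab; nra.
have [B [B0 dB]] := continuous_antiderivative ch.
have B1 : 0 < B 1.
  have [||||c cab E] := @is_derivI_MVT _ B h a b; rewrite //.
    by move=> x xab; apply: dB; lra.
  have hle := @is_derivI_homo_le _ B h 0 1 (lexx _) (lexx _) dB (fun x _ => h0 x).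
  have : B 0 <= B a by apply: hle => //; lra.
  have : B b <= B 1 by apply: hle => //; lra.
  have : 0 < h c * (b - a).
    rewrite mulr_gt0 ?subr_gt0 // /h lt_max mulr_gt0 ?orbT //; lra.
  lra.
exists (fun x => (B 1)^-1 * B x), (fun x => (B 1)^-1 * h x); split.
- by rewrite B0 mulr0.
- by rewrite mulVf // gt_eqF.
- by move=> x x01; apply: is_derivIZ; exact: dB.
- by move=> x x01; apply: contIM => //; [exact: contI_cst|exact: ch].
- split=> x; first by rewrite mulr_ge0 // invr_ge0 ltW.
  by move=> /hout ->; rewrite mulr0.
Qed.

(** F - id has zero derivative on [0, a] and on [b, 1] and vanishes at 0 and 1. *)
Lemma deriv1_supported a b F : 0 <= a -> b <= 1 ->
  (forall x, 0 <= x <= 1 -> x <= a \/ b <= x -> derivI F x = 1) -> supported a b F.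
Proof.
move=> a0 b1 dF x; have [x01|x01] := boolP (0 <= x <= 1); last by rewrite diff_out.
have dB y : 0 <= y <= 1 -> is_derivI (fun z => F z - z) y (derivI F y - 1).
  by move=> y01; apply: is_derivIB; [exact: diff_is_derivI|exact: is_derivI_id].
split=> xa.
  have H : `|F 0 - 0 - (F x - x)| <= 0 * `|0 - x|.
    apply: (@is_derivI_lipschitz _ (fun y => F y - y) (fun y => derivI F y - 1) 0 x 0); try lra.
      by move=> y yx; apply: dB; lra.
    by move=> y yx; rewrite dF ?subrr ?normr0 //; [lra|left; lra].
  move: H; rewrite mul0r normr_le0 diffC1_0 subrr sub0r oppr_eq0 subr_eq0.
  exact: eqP.
have H : `|F 1 - 1 - (F x - x)| <= 0 * `|1 - x|.
  apply: (@is_derivI_lipschitz _ (fun y => F y - y) (fun y => derivI F y - 1) x 1 0); try lra.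
    by move=> y yx; apply: dB; lra.
  by move=> y yx; rewrite dF ?subrr ?normr0 //; [lra|right; lra].
move: H; rewrite mul0r normr_le0 diffC1_1 subrr sub0r oppr_eq0 subr_eq0.
exact: eqP.
Qed.

Lemma supportedX a b F n : supported a b F -> supported a b (F ^+ n)%g.
Proof.
move=> Fs; elim: n => [|n IHn]; first by rewrite expg0; exact: supported1.
by rewrite expgS; exact: supportedM.
Qed.

Lemma diffX_ge F x n : x <= F x -> x <= (F ^+ n)%g x.
Proof.
move=> xF; elim: n => [|n IHn]; first by rewrite expg0.
by rewrite expgS diffC1M (le_trans xF) // diff_le.
Qed.

Lemma diffX_le F x n : F x <= x -> (F ^+ n)%g x <= x.
Proof.
move=> xF; elim: n => [|n IHn]; first by rewrite expg0.
by rewrite expgS diffC1M (le_trans _ xF) // diff_le.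
Qed.

(** The logarithm turns the chain rule into an additive cocycle, and at a common fixed point into a
    homomorphism to the reals. *)
Definition log_deriv F x := ln (derivI F x).

Lemma log_deriv_cont F x : 0 <= x <= 1 -> contI (log_deriv F) x.
Proof.
move=> x01; apply: contI_continuous_comp => //; first exact: diff_deriv_cont.
by apply: continuous_ln; exact: diff_deriv_gt0.
Qed.

Lemma log_deriv_mulg F G x : 0 <= x <= 1 ->
  log_deriv (F * G)%g x = log_deriv F (G x) + log_deriv G x.
Proof.
by move=> x01; rewrite /log_deriv deriv_mulg // lnM // posrE diff_deriv_gt0 // diff_itv.
Qed.

Definition parabolic F := forall x, 0 <= x <= 1 -> F x = x -> derivI F x = 1.

(* Away from its fixed points F moves points by a definite amount. *)
Lemma parabolic_log_deriv F e : parabolic F -> 0 < e ->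
  exists2 C, 0 < C & forall x, 0 <= x <= 1 -> `|log_deriv F x| <= e + C * `|F x - x|.
Proof.
move=> pF e0.
have [||m m0 mP] := @contI_gt0_min _ (fun x => Num.max `|F x - x| (e - `|log_deriv F x|)).
- move=> x x01; apply: contI_max => //.
    by apply: contI_norm => //; apply: contIB => //; [exact: diff_cont|exact: contI_id].
  apply: contIB => //; first exact: contI_cst.
  by apply: contI_norm => //; exact: log_deriv_cont.
- move=> x x01; rewrite lt_max; have [E|nE] := eqVneq (F x) x.
    by rewrite /log_deriv pF // ln1 normr0 subr0 e0 orbT.
  by rewrite normr_gt0 subr_eq0 nE.
have [M M0 MP] := contI_bounded (@log_deriv_cont F).
exists (M / m); first exact: divr_gt0.
move=> x x01; have := mP x x01; rewrite le_max => /orP[H|H].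
  apply: le_trans (MP x x01) _; apply: ler_wpDl; first exact: ltW.
  by rewrite mulrAC ler_pdivlMr // ler_pM2l.
have : 0 <= M / m * `|F x - x| by rewrite mulr_ge0 // ltW // divr_gt0.
lra.
Qed.

(* The orbit of x is monotone, so its displacements add up to |F^n x - x|. *)
Lemma log_derivX_le F e C n x : 0 <= x <= 1 ->
  (forall y, 0 <= y <= 1 -> `|log_deriv F y| <= e + C * `|F y - y|) ->
  `|log_deriv (F ^+ n)%g x| <= n%:R * e + C * `|(F ^+ n)%g x - x|.
Proof.
move=> + H; elim: n x => [|n IHn] x x01.
  by rewrite expg0 /log_deriv deriv_one // ln1 normr0 mul0r add0r subrr normr0 mulr0.
rewrite expgSr log_deriv_mulg // diffC1M (le_trans (ler_normD _ _)) //.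
have {}IHn := IHn _ (diff_itv F x01); have {}H := H x x01.
apply: le_trans (lerD IHn H) _.
suff -> : `|(F ^+ n)%g (F x) - x| = `|(F ^+ n)%g (F x) - F x| + `|F x - x|.
  by rewrite mulrDr -natr1 mulrDl mul1r addrACA.
have [xF|/ltW xF] := leP x (F x).
  have FF : F x <= F (F x) by rewrite diff_le.
  have FnF := diffX_ge n FF.
  by rewrite !ger0_norm ?subr_ge0 //; [ring|exact: le_trans FnF].
have FF : F (F x) <= F x by rewrite diff_le.
have FnF := diffX_le n FF.
by rewrite !ler0_norm ?subr_le0 //; [ring|exact: le_trans xF].
Qed.

Lemma diffC1_displacement_le1 F x : 0 <= x <= 1 -> `|F x - x| <= 1.
Proof. by move=> x01; have := diff_itv F x01; rewrite ler_norml; lra. Qed.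

(** The displacement of an iterate is at most 1, so dividing the bound of [log_derivX_le] by [n]
    leaves d / 2 + C / n. *)
Lemma log_derivX_average F n C d x : 0 <= x <= 1 -> (0 < n)%N -> 0 < C ->
  C / n%:R <= d / 2 ->
  (forall y, 0 <= y <= 1 -> `|log_deriv F y| <= d / 2 + C * `|F y - y|) ->
  `|n%:R^-1 * log_deriv (F ^+ n)%g x| <= d.
Proof.
move=> x01 n0 C0 Cn CP; have nR : (0 : R) < n%:R by rewrite ltr0n.
rewrite normrM gtr0_norm ?invr_gt0 // mulrC ler_pdivrMr //.
apply: le_trans (log_derivX_le n x01 CP) _; rewrite ler_pdivrMr // in Cn.
have : C * `|(F ^+ n)%g x - x| <= C.
  by rewrite ler_piMr ?(ltW C0) //; exact: diffC1_displacement_le1.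
move: (C * _) => D; lra.
Qed.

Lemma sum_shift n (u v : nat -> R) c : (forall i, u i + c = v i.+1) ->
  \sum_(i < n) u i + n%:R * c = \sum_(i < n) v i + v n - v 0.
Proof.
move=> uv; elim: n => [|n IHn]; first by rewrite !big_ord0 mul0r !add0r subrr.
rewrite !big_ord_recr /= -uv -natr1 mulrDl mul1r; move: IHn.
move: (\sum_(i < n) u i) (\sum_(i < n) v i) (u n) (v n) (v 0) (n%:R * c) => *; lra.
Qed.

(** Telescoping of the cocycle relation log (F^i)'(F x) + log F'(x) = log (F^(i+1))'(x); the term of
    index 0 vanishes. *)
Lemma sum_log_derivX F n x : 0 <= x <= 1 ->
  \sum_(i < n) log_deriv (F ^+ i)%g (F x) + n%:R * log_deriv F x =
  \sum_(i < n) log_deriv (F ^+ i)%g x + log_deriv (F ^+ n)%g x.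
Proof.
move=> x01; rewrite (@sum_shift n (fun i => log_deriv (F ^+ i)%g (F x))
    (fun i => log_deriv (F ^+ i)%g x) (log_deriv F x)).
  by rewrite expg0 /log_deriv deriv_one // ln1 subr0.
by move=> i; rewrite expgSr log_deriv_mulg.
Qed.

(** The left side of the conclusion is the derivative of G F G^-1 at G x, for a [G] whose derivative
    at [x] and at [F x] is the geometric mean of the derivatives of the first [n] iterates. *)
Lemma geometric_mean_cocycle F G n x : 0 <= x <= 1 -> (0 < n)%N ->
  derivI G x = expR (n%:R^-1 * \sum_(i < n) log_deriv (F ^+ i)%g x) ->
  derivI G (F x) = expR (n%:R^-1 * \sum_(i < n) log_deriv (F ^+ i)%g (F x)) ->
  derivI G (F x) * derivI F x / derivI G x = expR (n%:R^-1 * log_deriv (F ^+ n)%g x).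
Proof.
move=> x01 n0 -> ->; rewrite -[derivI F x]lnK ?posrE ?diff_deriv_gt0 //.
rewrite -expRD -expRN -expRD; congr expR; rewrite -/(log_deriv F x).
have nR : n%:R != 0 :> R by rewrite pnatr_eq0 -lt0n.
have -> : log_deriv (F ^+ n)%g x = \sum_(i < n) log_deriv (F ^+ i)%g (F x) +
    n%:R * log_deriv F x - \sum_(i < n) log_deriv (F ^+ i)%g x.
  by rewrite sum_log_derivX // addrAC subrr add0r.
by rewrite mulrBr mulrDr mulKf.
Qed.

Lemma expR_near0 e : 0 < e -> exists2 d, 0 < d & forall t : R, `|t| <= d -> `|expR t - 1| <= e.
Proof.
move=> e0; have /cvgrPdist_le /(_ _ e0) := @continuous_expR R 0.
rewrite expR0 => /nbhs_ballP[d /= d0 dP]; exists (d / 2); first exact: divr_gt0.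
by move=> t td; rewrite distrC; apply: dP; rewrite /ball /= sub0r normrN; lra.
Qed.

(* The conjugator has derivative the geometric mean of the derivatives of
   1, F, .., F^(n-1): conjugating replaces F' by ((F^n)')^(1/n). Its integral is
   at most 1 by AM-GM; the missing mass is put in [a0, a], where F = id. *)
Lemma parabolic_conjugate a0 a b F e : 0 < a0 -> a0 < a -> a < b -> b < 1 ->
  supported a b F -> parabolic F -> 0 < e ->
  exists2 G, supported a0 b G & distC1 (G * F * G^-1)%g 1%g <= e.
Proof.
move=> a00 a0a ab b1 Fs pF e0.
have [d d0 dP] := expR_near0 e0.
have [C C0 CP] := parabolic_log_deriv pF (divr_gt0 d0 (ltr0Sn R 1)).
have [n [n0 nP]] : exists n, (0 < n)%N /\ C / n%:R <= d / 2.
  exists (Num.truncn (2 * C / d)).+1; split=> //.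
  have nb : 2 * C / d <= (Num.truncn (2 * C / d)).+1%:R.
    by rewrite ltW // truncnS_gt.
  rewrite ler_pdivrMr // mulrC; rewrite ler_pdivrMr // in nb; lra.
have nR : (0 : R) < n%:R by rewrite ltr0n.
pose S x := \sum_(i < n) log_deriv (F ^+ i)%g x.
pose rho x := expR (n%:R^-1 * S x).
have rho0 x : 0 < rho x by exact: expR_gt0.
have crho x : 0 <= x <= 1 -> contI rho x.
  move=> x01; apply: contI_continuous_comp; [by []| |exact: continuous_expR].
  apply: contIM => //; first exact: contI_cst.
  by apply: (@contI_sum _ n (fun i => log_deriv (F ^+ i)%g)) => // i; exact: log_deriv_cont.
have rho1 x : 0 <= x <= 1 -> x <= a \/ b <= x -> rho x = 1.
  move=> x01 xab; rewrite /rho /S big1 ?mulr0 ?expR0 // => i _.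
  rewrite /log_deriv (@supported_deriv _ a b) ?ln1 //; first exact: lt_trans a0a.
  exact: supportedX.
have [P [P0 dP']] := continuous_antiderivative crho.
(* [P] is compared with the average of the iterates F^i, i < n, which also vanishes at 0, equals 1
   at 1, and by AM-GM has derivative at least [rho]. *)
have P1 : P 1 <= 1.
  have Q0 x : \sum_(i < n) (fun=> x) i = n%:R * x.
    by rewrite sumr_const card_ord mulr_natl.
  pose dQ x := n%:R^-1 * \sum_(i < n) derivI (F ^+ i)%g x.
  have dQP x : 0 <= x <= 1 -> is_derivI (fun y => n%:R^-1 * \sum_(i < n) (F ^+ i)%g y) x (dQ x).
    move=> x01; apply: is_derivIZ; rewrite {nP n0 nR S rho rho0 crho rho1 P P0 dP' Q0 dQ}.
    elim: n => [|n IHn].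
      rewrite (_ : (fun y => _) = fun=> 0); last by apply/funext => y; rewrite big_ord0.
      by rewrite big_ord0; exact: is_derivI_cst.
    rewrite (_ : (fun y => _) = fun y => \sum_(i < n) (F ^+ i)%g y + (F ^+ n)%g y).
      by rewrite big_ord_recr; apply: is_derivID => //; exact: diff_is_derivI.
    by apply/funext => y; rewrite big_ord_recr.
  have := @is_derivI_homo_le _ _ (fun x => dQ x - rho x) 0 1 (lexx _) (lexx _)
    (fun x x01 => is_derivIB (dQP x x01) (dP' x x01)) _ 0 1 (lexx _) ler01 (lexx _).
  rewrite P0 subr0 big1 ?mulr0; last by move=> i _; rewrite diffC1_0.
  rewrite [X in n%:R^-1 * X](_ : _ = n%:R); last first.
    by rewrite -[RHS]mulr1 -Q0; apply: eq_bigr => i _; rewrite diffC1_1.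
  rewrite mulVf ?gt_eqF // subr_ge0; apply => x x01; rewrite subr_ge0.
  by apply: (@AMGM_expR n (fun i => derivI (F ^+ i)%g x)) => // i; exact: diff_deriv_gt0.
have [B [db [B0 B1 dB cdb [db0 dbout]]]] := bump_step (ltW a00) a0a (ltW (lt_trans ab b1)).
have [||x x01|x x01|x x01|G GP] := @diff_of_derivative _ (fun x => P x + (1 - P 1) * B x)
  (fun x => rho x + (1 - P 1) * db x).
- by rewrite P0 B0 mulr0 addr0.
- by rewrite B1 mulr1 addrCA subrr addr0.
- by apply: is_derivID; [exact: dP'|apply: is_derivIZ; exact: dB].
- apply: contID => //; first exact: crho.
  by apply: contIM => //; [exact: contI_cst|exact: cdb].
- by rewrite ltr_wpDr // mulr_ge0 // subr_ge0.
exists G.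
  apply: deriv1_supported; [exact: ltW|exact: ltW|move=> x x01 xab].
  rewrite (GP x x01).2 rho1 // ?dbout ?mulr0 ?addr0 //; case: xab; lra.
apply: distC1_le => y; have [x <- y01] := diffC1_surj G y.
have x01 : 0 <= x <= 1 by rewrite -(diff_itvE G).
have Fx01 := diff_itv F x01.
rewrite deriv_one // deriv_mulg // deriv_invg // diffC1K deriv_mulg //.
(* Up to [a] the point is fixed with derivative 1 and conjugation changes nothing. Beyond [a], both
   [x] and [F x] are outside the bump, so G' is exactly [rho] at both. *)
have [xa|ax] := leP x a.
  rewrite (Fs x).1 // (@supported_deriv _ a b F) //; [|lra|by left].
  by rewrite mulr1 mulfV ?subrr ?normr0 ?(ltW e0) // gt_eqF // diff_deriv_gt0.
have aFx : a <= F x by rewrite -(Fs a).1 // diff_le ltW.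
have Gx : derivI G x = rho x.
  by rewrite (GP x x01).2 dbout ?mulr0 ?addr0 //; right; exact: ltW.
have GFx : derivI G (F x) = rho (F x).
  have dFx : db (F x) = 0 by apply: dbout; right.
  have [_ ->] := GP (F x) Fx01.
  rewrite dFx mulr0.
  exact: addr0.
rewrite (geometric_mean_cocycle x01 n0 Gx GFx); apply: dP.
exact: log_derivX_average x01 n0 C0 nP CP.
Qed.

(** G F^-1 G^-1 is the inverse of the nearly trivial G F G^-1, so the commutator of [F] and [G] is
    [F] times an element close to 1. *)
Lemma parabolic_commutator_limit a0 a b F e : 0 < a0 -> a0 < a -> a < b -> b < 1 ->
  supported a b F -> parabolic F -> 0 < e ->
  exists2 G, supported a0 b G & distC1 F (F * (G * F^-1 * G^-1))%g <= e.
Proof.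
move=> a00 a0a ab b1 Fs pF e0.
have [d d0 dP] := mulg_continuous_r F 1%g e0.
pose d' := Num.min (1 / 2) (d / 2).
have d'0 : 0 < d' by rewrite lt_min !divr_gt0.
have [G Gs GF] := parabolic_conjugate a00 a0a ab b1 Fs pF d'0.
exists G => //; rewrite -{1}[F]mulg1; apply: dP.
rewrite distC1_sym (_ : _ * _ * _ = (G * F * G^-1)^-1)%g; last first.
  by rewrite !invgM invgK mulgA.
apply: le_trans (distC1_inv1 _ GF) _; first by rewrite ge_min lexx.
have : d' <= d / 2 by rewrite ge_min lexx orbT.
lra.
Qed.
End parabolic_diffeomorphisms.

(** * Factorisation into small steps, separability, and a null sequence of generators *)

Section small_steps.
Variable R : realType.
Implicit Types (F G K : diffC1 R) (x y a b e t : R) (n i k N : nat).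

Lemma natr_inv_le e : 0 < e -> exists n, n.+1%:R^-1 <= e.
Proof.
move=> e0; exists (Num.truncn e^-1).
by rewrite invf_ple ?posrE ?ltr0n // ltW // truncnS_gt.
Qed.

(** The derivative is a convex combination of 1 and F', hence positive. For [t] outside [0, 1] the
    choice function takes the default 1. *)
Lemma convex_path F : exists P : R -> diffC1 R, forall t, 0 <= t <= 1 ->
  forall x, 0 <= x <= 1 ->
  P t x = x + t * (F x - x) /\ derivI (P t) x = 1 + t * (derivI F x - 1).
Proof.
suff /choice[P PP] : forall t, exists G : diffC1 R, 0 <= t <= 1 -> forall x, 0 <= x <= 1 ->
  G x = x + t * (F x - x) /\ derivI G x = 1 + t * (derivI F x - 1) by exists P.
move=> t; have [t01|nt01] := boolP (0 <= t <= 1); last by exists 1%g => t01; case/negP: nt01.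
have [||x x01|x x01|x x01|G GP] := @diff_of_derivative _ (fun x => x + t * (F x - x))
  (fun x => 1 + t * (derivI F x - 1)).
- by rewrite diffC1_0 subrr mulr0 addr0.
- by rewrite diffC1_1 subrr mulr0 addr0.
- apply: is_derivID; first exact: is_derivI_id.
  by apply: is_derivIZ; apply: is_derivIB; [exact: diff_is_derivI|exact: is_derivI_id].
- apply: contID => //; first exact: contI_cst.
  apply: contIM => //; first exact: contI_cst.
  by apply: contIB => //; [exact: diff_deriv_cont|exact: contI_cst].
- have := diff_deriv_gt0 F x01; move: (derivI F x) => u u0.
  have [t0|t0] := eqVneq t 0; first by rewrite t0 mul0r addr0.
  have tp : 0 < t by rewrite lt_neqAle eq_sym t0; case/andP: t01.
  have := mulr_gt0 tp u0; lra.
- by exists G => _.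
Qed.

(** With u = F'(x), the quotient is the derivative of the step P_s P_t^-1 of the convex path at
    P_t(x). Its numerator after subtracting 1 is (s - t)(u - 1), and its denominator is at least
    [m]. *)
Lemma path_step_deriv (u t s M m e : R) : 0 < m -> 0 <= t <= 1 -> m <= u -> m <= 1 ->
  u <= M -> 1 <= M -> `|s - t| * M <= e * m ->
  `|(1 + s * (u - 1)) / (1 + t * (u - 1)) - 1| <= e.
Proof.
move=> m0 t01 mu m1 uM M1 H.
have tu : m <= 1 + t * (u - 1) by nra.
have tu0 : 0 < 1 + t * (u - 1) by exact: lt_le_trans tu.
rewrite (_ : _ / _ - 1 = (s - t) * (u - 1) / (1 + t * (u - 1))); last by field; rewrite gt_eqF.
rewrite normrM [X in _ * X]gtr0_norm ?invr_gt0 // ler_pdivrMr // normrM.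
have u1 : `|u - 1| <= M by rewrite ler_norml; apply/andP; split; lra.
have e0 : 0 <= e by rewrite -(pmulr_lge0 _ m0); apply: le_trans H; rewrite mulr_ge0 //; lra.
apply: (@le_trans _ _ (`|s - t| * M)); first by rewrite ler_wpM2l.
by apply: le_trans H _; rewrite ler_wpM2l.
Qed.

(** The convex path is cut at the times i / N, with N large in terms of the extrema of F'. Points
    fixed by [F] stay fixed along the path, which preserves supports. *)
Lemma small_steps F e : 0 < e -> exists N (P : nat -> diffC1 R),
  [/\ P 0 = 1%g, P N = F,
      forall i, (i < N)%N -> distC1 (P i.+1 * (P i)^-1)%g 1%g <= e &
      forall a b, supported a b F -> forall i, (i <= N)%N -> supported a b (P i)].
Proof.
move=> e0; have [P PP] := convex_path F.
have [M0 M00 MP] := diff_deriv_bounded F.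
have [m0 m00 mP] := contI_gt0_min (@diff_deriv_cont _ F) (@diff_deriv_gt0 _ F).
pose m := Num.min m0 1; pose M := Num.max M0 1.
have mgt0 : 0 < m by rewrite lt_min m00 ltr01.
have Mgt0 : 0 < M by rewrite lt_max M00.
have [n nP] := natr_inv_le (divr_gt0 (mulr_gt0 e0 mgt0) Mgt0).
pose N := n.+1; have NR : (0 : R) < N%:R by rewrite ltr0n.
have t01 i : (i <= N)%N -> 0 <= (i%:R / N%:R : R) <= 1.
  by move=> iN; rewrite divr_ge0 //= ler_pdivrMr // mul1r ler_nat.
exists N, (fun i => P (i%:R / N%:R)); split.
- apply: diffC1_ext => x; have [x01|x01] := boolP (0 <= x <= 1); last by rewrite !diff_out.
  by have [-> _] := PP _ (t01 0 isT) x x01; rewrite mul0r mul0r addr0.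
- apply: diffC1_ext => x; have [x01|x01] := boolP (0 <= x <= 1); last by rewrite !diff_out.
  by have [-> _] := PP _ (t01 N (leqnn N)) x x01; rewrite divff ?gt_eqF // mul1r addrC subrK.
- move=> i iN; apply: distC1_le => y; have [x <- y01] := diffC1_surj (P (i%:R / N%:R)) y.
  have x01 : 0 <= x <= 1 by rewrite -(diff_itvE (P (i%:R / N%:R))).
  rewrite deriv_one // deriv_mulg // deriv_invg // diffC1K.
  have [_ ->] := PP _ (t01 i (ltnW iN)) x x01.
  have [_ ->] := PP _ (t01 i.+1 iN) x x01.
  apply: (@path_step_deriv _ _ _ M m) => //; rewrite ?ge_min ?le_max ?lexx ?orbT ?mP ?MP //.
    exact: t01 (ltnW iN).
  rewrite -mulrBl -natrB // subSnn mul1r ger0_norm ?invr_ge0 //.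
  by rewrite -ler_pdivlMr.
- move=> a b Fs i iN x; have [x01|x01] := boolP (0 <= x <= 1); last by rewrite diff_out.
  have [-> _] := PP _ (t01 i iN) x x01.
  by split=> xa; rewrite ?((Fs x).1 xa) ?((Fs x).2 xa) subrr mulr0 addr0.
Qed.

Lemma small_steps_mem (A : set (diffC1 R)) N (P : nat -> diffC1 R) : is_subgroup A ->
  P 0 = 1%g -> (forall i, (i < N)%N -> A (P i.+1 * (P i)^-1)%g) -> A (P N).
Proof.
move=> /is_subgroupP[A1 AM AV] P0 H.
suff : forall i, (i <= N)%N -> A (P i) by exact.
elim=> [|i IHi iN]; first by rewrite P0.
by rewrite -(mulgVK (P i) (P i.+1)); apply: AM; [exact: H|exact/IHi/ltnW].
Qed.

(** The diffeomorphisms supported in [a, b] form a path-connected group, so a neighbourhood of 1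
    generates it. *)
Lemma supported_small_generation (A : set (diffC1 R)) a b e : is_subgroup A -> 0 < e ->
  (forall G, supported a b G -> distC1 G 1%g <= e -> A G) ->
  forall F, supported a b F -> A F.
Proof.
move=> gA e0 H F Fs; have [N [P [P0 PN Pd Ps]]] := small_steps F e0.
rewrite -PN; apply: (@small_steps_mem A N P gA P0) => i iN; apply: H; last exact: Pd.
by apply: supportedM; [exact: Ps|apply: supportedV; apply: Ps => //; exact: ltnW].
Qed.

(** For a code (m, N, s), the mesh 1/(N+1) is a modulus of continuity of F' at precision 1/(m+1),
    and [s] lists the integer parts of (m+1) F' at the grid points. Codes are countable, which
    yields separability. *)
Definition has_code (c : nat * nat * seq nat) F :=
  (forall x y, 0 <= x <= 1 -> 0 <= y <= 1 -> `|y - x| <= c.1.2.+1%:R^-1 ->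
     `|derivI F y - derivI F x| <= c.1.1.+1%:R^-1) /\
  forall i, (i <= c.1.2.+1)%N ->
    Num.truncn (c.1.1.+1%:R * derivI F (i%:R / c.1.2.+1%:R)) = nth 0%N c.2 i.

Lemma truncn_eq_dist (u v : R) : 0 <= u -> 0 <= v ->
  Num.truncn u = Num.truncn v -> `|u - v| <= 1.
Proof.
move=> u0 v0 E; have /andP[] := truncn_itv u0; have /andP[] := truncn_itv v0.
by rewrite E -natr1 ler_norml => *; apply/andP; split; lra.
Qed.

(** Three errors of 1/(m+1): moving F' from [x] to the grid point [y] on its left, rounding at [y],
    and moving G' back to [x]. *)
Lemma has_code_dist c F G : has_code c F -> has_code c G ->
  distC1 F G <= 3 * c.1.1.+1%:R^-1.
Proof.
move=> [F1 F2] [G1 G2]; apply: distC1_le => x x01.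
set N := c.1.2.+1 in F1 F2 G1 G2; set m := c.1.1.+1 in F1 F2 G1 G2 *.
have NR : (0 : R) < N%:R by rewrite ltr0n.
have mR : (0 : R) < m%:R by rewrite ltr0n.
pose i := Num.truncn (N%:R * x); pose y : R := i%:R / N%:R.
have Nx0 : 0 <= N%:R * x by rewrite mulr_ge0 ?ler0n //; case/andP: x01.
have iNx : i%:R <= N%:R * x by rewrite truncn_le.
have Nxi : N%:R * x < i%:R + 1 by rewrite natr1 truncnS_gt.
have iN : (i <= N)%N.
  rewrite -(ler_nat R); apply: le_trans iNx _.
  by rewrite ler_piMr //; case/andP: x01.
have y01 : 0 <= y <= 1 by rewrite divr_ge0 //= ler_pdivrMr // mul1r ler_nat.
have xy : `|x - y| <= N%:R^-1.
  rewrite -(@ler_pM2l _ N%:R) // mulfV ?gt_eqF // -[X in X * _](gtr0_norm NR) -normrM.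
  rewrite mulrBr [X in _ - X](_ : _ = i%:R); last by rewrite /y mulrC divfK // gt_eqF.
  by rewrite ger0_norm ?subr_ge0 // ltW // ltrBlDl.
have A := F1 y x y01 x01 xy; have B := G1 y x y01 x01 xy.
have Fy := diff_deriv_gt0 F y01; have Gy := diff_deriv_gt0 G y01.
have C : `|derivI F y - derivI G y| <= m%:R^-1.
  have := F2 i iN; rewrite -(G2 i iN) -/y => E.
  rewrite -(@ler_pM2l _ m%:R) // mulfV ?gt_eqF // -[X in X * _](gtr0_norm mR) -normrM mulrBr.
  have Fm : 0 <= m%:R * derivI F y by rewrite mulr_ge0 // ltW.
  have Gm : 0 <= m%:R * derivI G y by rewrite mulr_ge0 // ltW.
  exact: truncn_eq_dist E.
move: A B C; move: (derivI F x) (derivI F y) (derivI G x) (derivI G y) m%:R^-1 => p q r s z A B C.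
rewrite (_ : p - r = (p - q) + (q - s) - (r - s)); last by ring.
rewrite (le_trans (ler_normB _ _)) //.
have := ler_normD (p - q) (q - s); lra.
Qed.

Lemma has_code_ex F e : 0 < e -> exists2 c, has_code c F & 3 * c.1.1.+1%:R^-1 <= e.
Proof.
move=> e0; have [m mP] := natr_inv_le (divr_gt0 e0 (ltr0Sn R 2)).
have m0 : (0 : R) < m.+1%:R^-1 by rewrite invr_gt0 ltr0n.
have [d d0 dP] := contI_compact_unif (@diff_deriv_cont _ F) m0.
have [N NP] := natr_inv_le (divr_gt0 d0 (ltr0Sn R 1)).
(* The grid has N + 2 points, both endpoints included. The bound d / 2 on the mesh turns the large
   inequality of the code into the strict one of uniform continuity. *)
exists (m, N, mkseq (fun i => Num.truncn (m.+1%:R * derivI F (i%:R / N.+1%:R))) N.+2) => /=.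
  split=> /= [x y x01 y01 yx|i iN]; last by rewrite nth_mkseq.
  by apply: dP => //; apply: le_lt_trans yx _; apply: le_lt_trans NP _; lra.
by rewrite -ler_pdivlMl // mulrC.
Qed.

(** One element of [S] is chosen for each code realised in [S], so the dense sequence lies in [S]
    itself; [F0] serves the other codes. *)
Lemma diffC1_separable (S : set (diffC1 R)) F0 : S F0 ->
  exists Q : nat -> diffC1 R, (forall k, S (Q k)) /\
    forall F, S F -> forall e, 0 < e -> exists k, distC1 F (Q k) <= e.
Proof.
move=> SF0; have [q qP] : exists q : nat * nat * seq nat -> diffC1 R, forall c,
    S (q c) /\ forall F, S F -> has_code c F -> has_code c (q c).
  suff /choice[q qP] : forall c, exists G,
      S G /\ forall F, S F -> has_code c F -> has_code c G by exists q.
  move=> c.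
  have [[G [SG cG]]|nex] := pselect (exists G, S G /\ has_code c G); first by exists G.
  by exists F0; split=> // F SF cF; case: nex; exists F.
exists (fun k => if unpickle k is Some c then q c else F0); split.
  by move=> k; case: unpickle => // c; have [] := qP c.
move=> F SF e e0; have [c cF ce] := has_code_ex F e0; exists (pickle c).
rewrite pickleK; apply: le_trans ce; apply: has_code_dist => //.
by have [_ H] := qP c; exact: H SF cF.
Qed.

(** For a dense sequence Q_k, a path to Q_k is cut into finitely many steps of size at most 1/(k+1).
    Enumerating all these steps by codes of pairs (k, i) gives a sequence tending to 1 whose
    products reach every Q_k. *)
Lemma null_sequence_generates a b : exists h : nat -> diffC1 R,
  [/\ forall n, supported a b (h n),
      forall e, 0 < e -> exists n0, forall n, (n0 <= n)%N -> distC1 (h n) 1%g <= e &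
      forall A : set (diffC1 R), is_subgroup A -> closure A `<=` A ->
        (forall n, A (h n)) -> forall F, supported a b F -> A F].
Proof.
have [Q [Qs Qd]] := @diffC1_separable (supported a b) 1%g (@supported1 R a b).
have /choice[N /choice[P PP]] : forall k, exists N (P : nat -> diffC1 R),
    [/\ P 0 = 1%g, P N = Q k,
      forall i, (i < N)%N -> distC1 (P i.+1 * (P i)^-1)%g 1%g <= k.+1%:R^-1 &
      forall a b, supported a b (Q k) -> forall i, (i <= N)%N -> supported a b (P i)].
  by move=> k; apply: small_steps; rewrite invr_gt0 ltr0n.
pose step k i := (P k i.+1 * (P k i)^-1)%g.
pose h n := if pickle_inv n is Some (k, i) then
  if (i < N k)%N then step k i else 1%g else 1%g.
exists h; split.
- move=> n; rewrite /h; case: pickle_inv => [[k i]|]; last exact: supported1.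
  case: ifPn => iN; last exact: supported1.
  have [_ _ _ Ps] := PP k; apply: supportedM; first exact: Ps.
  by apply: supportedV; apply: Ps => //; exact: ltnW.
- move=> e e0; have [K Ke] := natr_inv_le e0.
  (* Beyond the codes of the steps of the paths with k < K, the remaining terms are 1 or steps of
     size at most 1/(K+1). *)
  exists (\max_(k < K) \max_(i < N k) pickle (k : nat, i : nat)).+1 => n nP.
  have d0 : distC1 (1%g : diffC1 R) 1%g <= e by rewrite distC1xx ltW.
  rewrite /h; case En : pickle_inv => [[k i]|//]; case: ifPn => // iN.
  have := @pickle_invK (nat * nat)%type n; rewrite En /= => {}En.
  have [_ _ Pd _] := PP k; apply: le_trans (Pd i iN) _; apply: le_trans Ke.
  rewrite lef_pV2 ?posrE ?ltr0n // ler_nat ltnS leqNgt; apply/negP => kK.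
  suff : (n < n)%N by rewrite ltnn.
  apply: leq_trans nP; rewrite ltnS -{1}En.
  apply: leq_trans (leq_bigmax (Ordinal kK)).
  exact: (@leq_bigmax _ (fun i : 'I_(N k) => pickle (k, i : nat)) (Ordinal iN)).
- move=> A gA cA Ah F Fs; apply: cA; apply/closure_distC1 => e e0.
  have [k Fk] := Qd F Fs e e0; exists (Q k) => //.
  have [P0 PN _ _] := PP k; rewrite -PN; apply: (@small_steps_mem A (N k) (P k) gA P0) => i iN.
  by have := Ah (pickle (k, i)); rewrite /h pickleK_inv iN.
Qed.
End small_steps.

(** * Encoding a null sequence in one diffeomorphism *)

Section infinite_products.
Variable R : realType.
Implicit Types (F G T c g h : diffC1 R) (x y a b e : R) (n i N M : nat).

(** Beyond 1/2 a quadratic term is added, with the coefficient 2 that makes the value at 1 equal to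
    1. *)
Lemma halving_diffeo : exists T, forall x, 0 <= x <= 1 / 2 ->
  T x = x / 2 /\ derivI T x = 1 / 2.
Proof.
pose p (x : R) := Num.max 0 (x - 1 / 2).
have [||x x01|x x01|x x01|T TP] := @diff_of_derivative R (fun x => x / 2 + 2 * p x ^+ 2)
  (fun x => 1 / 2 + 4 * p x).
- by rewrite /p max_l; [rewrite expr0n mulr0 mul0r addr0|lra].
- by rewrite /p max_r; [field|lra].
- apply: is_derivID.
    rewrite (_ : (fun y => _) = fun y => 2^-1 * y); last by apply/funext => y; rewrite mulrC.
    have H := @is_derivIZ _ 2^-1 _ _ _ (is_derivI_id x).
    by apply: is_derivI_eq H; rewrite mulr1 mul1r.
  have H := is_derivIB (is_derivI_id x) (is_derivI_cst (1 / 2) x).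
  have {}H := @is_derivIZ _ 2 _ _ _ (is_derivI_posqr x01 H).
  by apply: is_derivI_eq H; rewrite -/(p x) /=; ring.
- apply: contID => //; first exact: contI_cst.
  apply: contIM => //; first exact: contI_cst.
  by apply: contI_max => //; [exact: contI_cst|apply: contIB => //;
    [exact: contI_id|exact: contI_cst]].
- have : 0 <= p x by rewrite le_max lexx.
  by move: (p x) => u; lra.
exists T => x x2; have x01 : 0 <= x <= 1 by lra.
have [-> ->] := TP x x01; rewrite /p max_l; last by lra.
by rewrite expr0n !mulr0 !addr0.
Qed.

Section halving.
Variables (T : diffC1 R)
  (TP : forall x, 0 <= x <= 1 / 2 -> T x = x / 2 /\ derivI T x = 1 / 2).

(** [T] is linear on [0, 1/2], so its derivatives cancel in the conjugate: supports shrink while the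
    C^1 distance to 1 does not grow. *)
Lemma halving_conj a b c : 0 < a -> a <= b -> b <= 1 / 2 -> supported a b c ->
  supported (a / 2) (b / 2) (T * c * T^-1)%g /\ distC1 (T * c * T^-1)%g 1%g <= distC1 c 1%g.
Proof.
move=> a0 ab b2 cs; split.
  have := supportedJ T cs; have [|-> _] := TP (x := a); first lra.
  by have [|-> _] := TP (x := b); first lra.
apply: distC1_le => y; have [x <-] := diffC1_surj T y; rewrite diff_itvE => x01.
rewrite deriv_one ?diff_itvE // !deriv_mulg ?diff_itvE // deriv_invg // diffC1K.
have [x2|x2] := leP x (1 / 2).
  have cx : 0 <= c x <= 1 / 2.
    rewrite -{1}((cs 0).1 (ltW a0)) -{1}((cs (1 / 2)).2 b2) !diff_le x2 andbT.
    by case/andP: x01.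
  have [|_ ->] := TP (x := x); first by rewrite x2 andbT; case/andP: x01.
  have [//|_ ->] := TP (x := c x).
  rewrite mulrAC divff ?mul1r; last by rewrite gt_eqF // divr_gt0.
  by have := distC1_ge c 1%g x01; rewrite deriv_one.
have cx : c x = x by rewrite (cs x).2 //; lra.
rewrite cx (@supported_deriv _ a b c) //; [|lra|by right; lra].
by rewrite mulr1 divff ?subrr ?normr0 ?distC1_ge0 // gt_eqF // diff_deriv_gt0.
Qed.

(** T^n maps [1/4, 1/2] onto [scale n.+2, scale n.+1]; these intervals have disjoint interiors and
    accumulate only at 0. *)
Definition scale n : R := 2^-1 ^+ n.

Lemma scale_gt0 n : 0 < scale n. Proof. by rewrite exprn_gt0 // invr_gt0. Qed.

Lemma scaleS n : scale n.+1 = scale n / 2. Proof. by rewrite /scale exprSr. Qed.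

Lemma scale_le n N : (n <= N)%N -> scale N <= scale n.
Proof. by move=> nN; apply: ler_wiXn2l nN; rewrite ?invr_ge0 // invf_le1 // ler1n. Qed.

Lemma scale_le1 n : scale n <= 1.
Proof. by have := scale_le (leq0n n); rewrite /scale expr0. Qed.

Lemma scale_small x : 0 < x -> exists n, scale n <= x.
Proof.
move=> x0; have [n nx] := natr_inv_le x0; exists n; apply: le_trans nx.
rewrite /scale exprVn lef_pV2 ?posrE ?exprn_gt0 ?ltr0n //.
by rewrite -natrX ler_nat; exact: ltn_expl.
Qed.

Lemma halvingX n x : 0 <= x <= 1 / 2 -> (T ^+ n)%g x = x * scale n.
Proof.
move=> x2; elim: n => [|n IHn]; first by rewrite expg0 /scale expr0 mulr1.
rewrite expgS diffC1M IHn scaleS; have := scale_gt0 n; have := scale_le1 n.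
move: (scale n) => s s1 s0; have [|-> _] := TP (x := x * s); last by rewrite mulrA.
by apply/andP; split; nra.
Qed.

Lemma halvingX_conj n c : supported (1 / 4) (1 / 2) c ->
  supported (scale n.+2) (scale n.+1) (T ^+ n * c * (T ^+ n)^-1)%g /\
  distC1 (T ^+ n * c * (T ^+ n)^-1)%g 1%g <= distC1 c 1%g.
Proof.
move=> cs; elim: n => [|n [IHs IHd]].
  rewrite expg0 mul1g invg1 mulg1; split=> //.
  by rewrite !scaleS /scale expr0 (_ : 1 / 2 / 2 = 1 / 4) //; field.
rewrite expgS invgM !mulgA -[X in supported _ _ (X * _ * _)%g]mulgA.
rewrite -[X in distC1 (X * _ * _)%g]mulgA.
rewrite -[X in supported _ _ (X * _)%g]mulgA -[X in distC1 (X * _)%g]mulgA.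
have s1 : scale n.+1 <= 1 / 2 by have := scale_le (isT : (1 <= n.+1)%N); rewrite /scale expr1; lra.
have [|H1 H2] := halving_conj (scale_gt0 n.+2) _ s1 IHs; first exact: scale_le.
by split; [move: H1; rewrite -!scaleS|exact: le_trans H2 IHd].
Qed.

Section infinite_product.
Variable c : nat -> diffC1 R.
Hypothesis cs : forall n, supported (scale n.+2) (scale n.+1) (c n).
Hypothesis c_null : forall e, 0 < e -> exists n0, forall n, (n0 <= n)%N -> distC1 (c n) 1%g <= e.

Fixpoint partial_prod N : diffC1 R :=
  if N is N'.+1 then (partial_prod N' * c N')%g else 1%g.

Lemma scaleS_lt1 n : scale n.+1 < 1.
Proof. by have := scale_le (isT : (1 <= n.+1)%N); rewrite /scale expr1; lra. Qed.

Lemma partial_prod_supported N : supported (scale N.+1) 1 (partial_prod N).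
Proof.
elim: N => [|N IHN] /=; first exact: supported1.
apply: supportedM; first by apply: supportedW IHN => //; exact: scale_le.
by apply: supportedW (cs N) => //; exact: ltW (scaleS_lt1 N).
Qed.

Lemma partial_prodS_ge N x : scale N.+1 <= x -> x <= 1 ->
  partial_prod N.+1 x = partial_prod N x /\
  derivI (partial_prod N.+1) x = derivI (partial_prod N) x.
Proof.
move=> Nx x1; have x01 : 0 <= x <= 1 by rewrite x1 andbT (le_trans _ Nx) // ltW // scale_gt0.
rewrite [partial_prod N.+1]/(partial_prod N * c N)%g diffC1M deriv_mulg //.
rewrite (cs N x).2 //; split=> //.
rewrite (supported_deriv (scale_gt0 _) (scaleS_lt1 N) (cs N)) ?mulr1 //; by right.
Qed.

Lemma partial_prod_ge N M x : (N <= M)%N -> scale N.+1 <= x -> x <= 1 ->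
  partial_prod M x = partial_prod N x /\
  derivI (partial_prod M) x = derivI (partial_prod N) x.
Proof.
move=> NM Nx x1; rewrite -(subnK NM); elim: (M - N)%N => [//|k [IH1 IH2]].
have [||-> ->//] := @partial_prodS_ge (k + N) x; rewrite // (le_trans _ Nx) //.
by apply: scale_le; rewrite ltnS leq_addl.
Qed.

Lemma partial_prod_le N x : 0 <= x -> x <= scale N.+1 ->
  partial_prod N.+1 x = c N x /\ derivI (partial_prod N.+1) x = derivI (c N) x.
Proof.
move=> x0 xN; have x01 : 0 <= x <= 1 by rewrite x0 (le_trans xN) // ltW // scaleS_lt1.
have cx : c N x <= scale N.+1 by rewrite -((cs N (scale N.+1)).2 (lexx _)) diff_le.
rewrite [partial_prod N.+1]/(partial_prod N * c N)%g diffC1M deriv_mulg //.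
rewrite (partial_prod_supported N _).1 //; split=> //.
rewrite (_ : derivI (partial_prod N) (c N x) = 1) ?mul1r //.
have /andP[cx0 cx1] := diff_itv (c N) x01.
apply: (@is_derivI_unique_on _ (partial_prod N) id (c N x) _ _ 0 (scale N.+1)) => //.
- exact: ltW (scaleS_lt1 N).
- exact: scale_gt0.
- by rewrite cx0.
- by move=> y /andP[_ yN]; rewrite (partial_prod_supported N _).1.
- by apply: diff_is_derivI; rewrite cx0.
- exact: is_derivI_id.
Qed.

(** On [0, scale n0.+1] only factors of index at least [n0] have a derivative other than 1, and at
    each point at most one of them does. The bound is uniform in [N], hence passes to the infinite
    product. *)
Lemma partial_prod_near0 e n0 N x : (forall n, (n0 <= n)%N -> distC1 (c n) 1%g <= e) ->
  0 <= x -> x <= scale n0.+1 -> `|derivI (partial_prod N) x - 1| <= e.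
Proof.
move=> ce x0 xn0; have e0 : 0 <= e by exact: le_trans (distC1_ge0 _ _) (ce n0 (leqnn _)).
have x01 : 0 <= x <= 1 by rewrite x0 (le_trans xn0) // ltW // scaleS_lt1.
elim: N => [|N IHN]; first by rewrite /= deriv_one // subrr normr0.
have [xN|/ltW Nx] := leP x (scale N.+1); last first.
  by have [||_ ->] := @partial_prodS_ge N x; rewrite //; case/andP: x01.
have [_ ->] := partial_prod_le x0 xN.
have [n0N|Nn0] := leqP n0 N.
  by have := le_trans (distC1_ge (c N) 1%g x01) (ce N n0N); rewrite deriv_one.
rewrite (supported_deriv (scale_gt0 _) (scaleS_lt1 N) (cs N)) ?subrr ?normr0 //.
by left; apply: le_trans xn0 _; exact: scale_le.
Qed.

(* Only one factor acts near each positive point; at 0 the derivatives of the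
   factors tend to 1. *)
Lemma infinite_product : exists g, forall n x,
  scale n.+2 <= x -> x <= scale n.+1 -> g x = c n x.
Proof.
have /choice[Nf NfP] : forall x, exists N, 0 < x -> scale N.+1 <= x.
  move=> x; have [x0|x0] := ltP 0 x; last by exists 0%N.
  by have [N Nx] := scale_small x0; exists N => _; apply: le_trans Nx; exact: scale_le.
pose g x := partial_prod (Nf x) x.
pose dg x := if 0 < x then derivI (partial_prod (Nf x)) x else 1.
have gE N x : scale N.+1 <= x -> x <= 1 ->
    g x = partial_prod N x /\ dg x = derivI (partial_prod N) x.
  move=> Nx x1; have x0 : 0 < x by exact: lt_le_trans (scale_gt0 _) Nx.
  rewrite /g /dg x0; have [NM|/ltnW NM] := leqP N (Nf x).
    exact: partial_prod_ge.
  by have [-> ->] := partial_prod_ge NM (NfP x x0) x1.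
have g0 : g 0 = 0 by exact: diffC1_0.
have near0 e : 0 < e -> exists2 d, 0 < d & forall y, 0 <= y -> y < d ->
    `|g y - y| <= e * y /\ `|dg y - 1| <= e.
  move=> e0; have [n0 n0P] := c_null e0.
  exists (scale n0.+1); first exact: scale_gt0.
  move=> y y0 /ltW yn0; split; last first.
    rewrite /dg; case: ifP => _; first exact: partial_prod_near0 n0P y0 yn0.
    by rewrite subrr normr0 ltW.
  have y1 : y <= 1 by apply: le_trans yn0 _; exact: scale_le1.
  (* The mean value inequality is applied to the finite product that agrees with [g] at [y], the
     differentiability of [g] at 0 being still unknown. *)
  have := @is_derivI_lipschitz _ (fun x => partial_prod (Nf y) x - x)
    (fun x => derivI (partial_prod (Nf y)) x - 1) 0 y e (lexx _) y1 _ _ 0 y.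
  rewrite diffC1_0 !subr0 (ger0_norm y0); apply; rewrite ?lexx ?y0 //.
    move=> x xy; apply: is_derivIB; last exact: is_derivI_id.
    by apply: diff_is_derivI; lra.
  by move=> x /andP[x0 xy]; apply: partial_prod_near0 n0P x0 _; exact: le_trans yn0.
have nearx x : 0 < x -> x <= 1 -> exists2 d, 0 < d & exists N, forall y, 0 <= y <= 1 ->
    `|y - x| < d -> g y = partial_prod N y /\ dg y = derivI (partial_prod N) y.
  move=> x0 x1; have Nx := NfP x x0; set N := (Nf x).+1.
  have sN : scale N.+1 < x.
    by apply: lt_le_trans Nx; rewrite scaleS ltr_pdivrMr // ltr_pMr ?scale_gt0 // ltr1n.
  exists (x - scale N.+1); first by rewrite subr_gt0.
  exists N => y /andP[y0 y1]; rewrite ltr_norml => /andP[yx _].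
  by apply: gE => //; lra.
have [||x /andP[]|x /andP[]|x /andP[]|G GP] := @diff_of_derivative R g dg.
- exact: g0.
- exact: diffC1_1.
- rewrite le_eqVlt => /predU1P[<- _|x0 x1].
    rewrite /dg ltxx; apply/is_derivIP => e e0; have [d d0 dP] := near0 e e0.
    exists d => // y /andP[y0 y1]; rewrite subr0 g0 subr0 mul1r (ger0_norm y0) => yd.
    by have [] := dP y y0 yd.
  have [d d0 [N NP]] := nearx x x0 x1.
  have x01 : 0 <= x <= 1 by rewrite (ltW x0).
  have [|gx ->] := NP x x01; first by rewrite subrr normr0.
  apply: (@is_derivI_near _ (partial_prod N) g x _ d) => //.
    by move=> y y01 yd; have [->] := NP y y01 yd.
  exact: diff_is_derivI.
- rewrite le_eqVlt => /predU1P[<- _|x0 x1] e e0.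
    have [d d0 dP] := near0 e e0; exists d => // y /andP[y0 y1].
    by rewrite subr0 (ger0_norm y0) /dg ltxx => yd; have [] := dP y y0 yd.
  have [d d0 [N NP]] := nearx x x0 x1.
  have x01 : 0 <= x <= 1 by rewrite (ltW x0).
  have [d' d'0 d'P] := @diff_deriv_cont _ (partial_prod N) x x01 e e0.
  exists (Num.min d d'); first by rewrite lt_min d0.
  move=> y y01; rewrite lt_min => /andP[yd yd'].
  have [_ ->] := NP y y01 yd; have [|_ ->] := NP x x01; first by rewrite subrr normr0.
  exact: d'P.
- move=> x0 x1; rewrite /dg; case: ifP => // _.
  by apply: diff_deriv_gt0; rewrite x0.
exists G => n x nx xn; have x0 : 0 <= x by apply: le_trans nx; exact: ltW (scale_gt0 _).
have x1 : x <= 1 by apply: le_trans xn _; exact: scale_le1.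
have [|-> _] := GP x; first by rewrite x0.
have [-> _] := gE n.+1 x nx x1.
by have [-> _] := partial_prod_le x0 xn.
Qed.
End infinite_product.

(** On the image of [1/4, 1/2] under T^n, the product [g] of all the T^n h_n T^-n agrees with its
    factor of index [n]; conjugating back by T^n recovers h_n there. *)
Lemma encode_null_sequence (h : nat -> diffC1 R) :
  (forall n, supported (1 / 4) (1 / 2) (h n)) ->
  (forall e, 0 < e -> exists n0, forall n, (n0 <= n)%N -> distC1 (h n) 1%g <= e) ->
  exists g, forall n x, 1 / 4 <= x <= 1 / 2 ->
    ((T ^+ n)^-1 * g * T ^+ n)%g x = h n x.
Proof.
move=> hs h_null.
have [|e e0|g gP] := @infinite_product (fun n => (T ^+ n * h n * (T ^+ n)^-1)%g).
- by move=> n; have [] := halvingX_conj n (hs n).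
- have [n0 n0P] := h_null e e0; exists n0 => n nn0.
  by have [_ H] := halvingX_conj n (hs n); apply: le_trans H (n0P n nn0).
exists g => n x x2; have x01 : 0 <= x <= 1 / 2 by lra.
have Tx := halvingX n x01.
rewrite !diffC1M (gP n).
- by rewrite !diffC1M !diffC1K.
- by rewrite Tx !scaleS; have := scale_gt0 n; move: (scale n) => s s0; nra.
- by rewrite Tx !scaleS; have := scale_gt0 n; move: (scale n) => s s0; nra.
Qed.
End halving.
End infinite_products.

(** * From commutators to all compactly supported diffeomorphisms *)

Section generation.
Variable R : realType.
Implicit Types (A : set (diffC1 R)) (F G E r : diffC1 R) (x y a b c e : R) (n : nat).

Lemma exprn_small x e : 0 <= x -> x < 1 -> 0 < e -> exists n, x ^+ n <= e.
Proof.
move=> x0 x1 e0; have x1' : `|x| < 1 by rewrite ger0_norm.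
have /cvgrPdist_le /(_ _ e0)[n _ nP] := cvg_expr x1'.
exists n; have := nP n (leqnn n); rewrite /= sub0r normrN.
exact/le_trans/ler_norm.
Qed.

(** This is the derivative of u + w^-3 (u (w - u))^2. As u (w - u) is at most w^2 / 4 and |w - 2 u|
    at most w, it is at least 1/2. *)
Lemma bump_deriv_gt0 (w u : R) : 0 < w -> 0 <= u <= w ->
  0 < 1 + w^-3 * (2 * (u * (w - u)) * (w - 2 * u)).
Proof.
move=> w0 uw; have w3 : 0 < w ^+ 3 by rewrite exprn_gt0.
rewrite -(ltr_pM2l w3) mulr0 mulrDr mulr1 mulVKf ?gt_eqF //.
have uu : 0 <= u * (w - u) by rewrite mulr_ge0 //; lra.
have uw4 : u * (w - u) <= w ^+ 2 / 4 by have := sqr_ge0 (w - 2 * u); lra.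
have [H|H] := leP 0 (w - 2 * u).
  by apply: ltr_wpDr => //; rewrite mulr_ge0 // mulr_ge0.
have H2 : (u * (w - u)) * (2 * u - w) <= w ^+ 2 / 4 * w.
  by apply: ler_pM => //; lra.
have : w ^+ 2 / 4 * w = w ^+ 3 / 4 by field.
lra.
Qed.

(** The square makes the map parabolic: a fixed point is a zero of the positive part, which is also
    a factor of r' - 1. The explicit formula is kept for estimates of the displacement. *)
Lemma bump_diffeo a b : 0 < a -> a < b -> b < 1 -> exists r,
  [/\ supported a b r, parabolic r &
      forall x, 0 <= x <= 1 -> r x = x + (b - a)^-3 * Num.max 0 ((x - a) * (b - x)) ^+ 2].
Proof.
move=> a0 ab b1; pose q x := (x - a) * (b - x); pose k := (b - a)^-3.
have k0 : 0 < k by rewrite invr_gt0 exprn_gt0 // subr_gt0.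
have qd x : 0 <= x <= 1 -> is_derivI q x (b + a - 2 * x).
  move=> x01; have H1 := is_derivIB (is_derivI_id x) (is_derivI_cst a x).
  have H2 := is_derivIB (is_derivI_cst b x) (is_derivI_id x).
  have H3 := is_derivIM x01 H1 H2.
  by apply: is_derivI_eq H3; ring.
have q0 x : x <= a \/ b <= x -> Num.max 0 (q x) = 0.
  by move=> xab; apply: max_l; rewrite /q; case: xab => ?; nra.
have q1 x : a <= x <= b -> Num.max 0 (q x) = q x.
  by move=> xab; apply: max_r; rewrite /q; nra.
pose dr x := 1 + k * (2 * Num.max 0 (q x) * (b + a - 2 * x)).
have [||x x01|x x01|x x01|r rP] := @diff_of_derivative R
    (fun x => x + k * Num.max 0 (q x) ^+ 2) dr.
- by rewrite q0; [rewrite expr0n mulr0 addr0|left; lra].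
- by rewrite q0; [rewrite expr0n mulr0 addr0|right; lra].
- apply: is_derivID; first exact: is_derivI_id.
  by have H := @is_derivIZ _ k _ _ _ (is_derivI_posqr x01 (qd x x01)).
- apply: contID => //; first exact: contI_cst.
  apply: contIM => //; first exact: contI_cst.
  have cq : contI q x by exact: is_derivI_cont (qd x x01).
  apply: contIM => //.
    apply: contIM => //; first exact: contI_cst.
    by apply: contI_max => //; exact: contI_cst.
  apply: contIB => //; first exact: contI_cst.
  by apply: contIM => //; [exact: contI_cst|exact: contI_id].
- rewrite /dr; have [xa|ax] := leP x a; first by rewrite q0 ?mulr0 ?mul0r ?mulr0 ?addr0 //; left.
  have [bx|xb] := leP b x; first by rewrite q0 ?mulr0 ?mul0r ?mulr0 ?addr0 //; right.
  have := @bump_deriv_gt0 (b - a) (x - a); rewrite subr_gt0 => /(_ ab).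
  have -> : 0 <= x - a <= b - a by apply/andP; split; lra.
  move=> /(_ isT).
  rewrite q1; last by apply/andP; split; lra.
  rewrite /q /k (_ : b + a - 2 * x = b - a - 2 * (x - a)); last by ring.
  by rewrite (_ : b - x = b - a - (x - a)) //; ring.
exists r; split.
- apply: deriv1_supported; [exact: ltW|exact: ltW|move=> x x01 xab].
  by rewrite (rP x x01).2 /dr q0 // mulr0 mul0r mulr0 addr0.
- move=> x x01; have [-> ->] := rP x x01 => /eqP.
  rewrite -subr_eq0 addrAC subrr add0r mulf_eq0 gt_eqF //= sqrf_eq0 => /eqP H.
  by rewrite /dr H mulr0 mul0r mulr0 addr0.
- by move=> x x01; have [->] := rP x x01.
Qed.

(** The bump [r] moves every point of (a, b) to the right, by at least 2e on [u1, u2]. If [G] is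
    e-close to 1, then G x = r x is impossible in (a, b), so r^-1 G has no fixed point there and is
    parabolic; G = r (r^-1 G). *)
Lemma parabolic_generation A a b u1 u2 : 0 < a -> a < u1 -> u1 < u2 -> u2 < b -> b < 1 ->
  is_subgroup A -> (forall F, supported a b F -> parabolic F -> A F) ->
  forall F, supported u1 u2 F -> A F.
Proof.
move=> a0 au u12 ub b1 gA HA.
have ab : a < b by lra.
have [r [rs pr rE]] := bump_diffeo a0 ab b1.
have Ar := HA r rs pr; have k0 : 0 < (b - a)^-3 by rewrite invr_gt0 exprn_gt0 // subr_gt0.
have r_gt x : a < x < b -> x < r x.
  move=> xab; rewrite rE; last lra.
  rewrite ltrDl mulr_gt0 // exprn_gt0 // lt_max mulr_gt0 ?orbT //; lra.
pose e := (b - a)^-3 * ((u1 - a) * (b - u2)) ^+ 2 / 2.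
have q0 : 0 < (u1 - a) * (b - u2) by rewrite mulr_gt0 //; lra.
have e0 : 0 < e by rewrite divr_gt0 // mulr_gt0 // exprn_gt0.
have r_ge x : u1 <= x <= u2 -> x + 2 * e <= r x.
  move=> xu; rewrite rE; last lra.
  rewrite lerD2l /e mulrC divfK // ler_pM2l // ler_sqr ?nnegrE ?le_max ?lexx ?(ltW q0) //.
  by apply/orP; right; apply: ler_pM; lra.
apply: (@supported_small_generation _ A u1 u2 e gA e0) => G Gs Ge.
have /is_subgroupP[_ AM _] := gA; rewrite -(mulVKg r G); apply: AM => //.
have Gs' : supported a b G by apply: supportedW Gs; lra.
have rGs : supported a b (r^-1 * G)%g by apply: supportedM => //; exact: supportedV.
apply: HA => // x x01 /(congr1 r); rewrite diffC1M diffC1VK => Gr.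
apply: (supported_deriv a0 b1 rGs x01).
have [xa|ax] := leP x a; first by left.
have [bx|xb] := leP b x; first by right.
have xr : x < r x by apply: r_gt; rewrite ax.
have [xu|ux] := leP x u1; first by rewrite -Gr (Gs x).1 // ltxx in xr.
have [ux2|xu2] := leP u2 x; first by rewrite -Gr (Gs x).2 // ltxx in xr.
have := le_distC1 G 1%g x01; rewrite Gr diffC1_1E => H.
have : x + 2 * e <= r x by apply: r_ge; lra.
have : distC1 G 1%g * x <= e by apply: le_trans Ge; rewrite ler_piMr ?distC1_ge0 //; lra.
by move: H; rewrite ler_norml; lra.
Qed.

Lemma closure_closed_mem A F : closure A `<=` A ->
  (forall e, 0 < e -> exists2 G, A G & distC1 F G <= e) -> A F.
Proof. by move=> cA H; apply: cA; apply/closure_distC1. Qed.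

Lemma commutators_generate A a0 a b F : 0 < a0 -> a0 < a -> a < b -> b < 1 ->
  closure A `<=` A ->
  (forall G H : diffC1 R, supported a0 b G -> supported a0 b H -> A (G * H * G^-1 * H^-1)%g) ->
  supported a b F -> parabolic F -> A F.
Proof.
move=> a00 a0a ab b1 cA AC Fs pF; apply: closure_closed_mem => // e e0.
have [G Gs Ge] := parabolic_commutator_limit a00 a0a ab b1 Fs pF e0.
exists (F * (G * F^-1 * G^-1))%g => //; rewrite !mulgA; apply: AC => //.
by apply: supportedW Fs => //; exact: ltW.
Qed.

(** Both conjugates are required because F A F^-1 contained in A is not by itself a condition stable
    under inversion. *)
Lemma normaliser_is_subgroup A : is_subgroup A ->
  is_subgroup [set F | forall X, A X -> A (F * X * F^-1)%g /\ A (F^-1 * X * F)%g].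
Proof.
move=> /is_subgroupP[A1 AM AV]; apply/is_subgroupP; split=> [X AX|F G HF HG X AX|F HF X AX] /=.
- by rewrite invg1 !mul1g !mulg1.
- have [A1G A2G] := HG X AX; have [A1F A2F] := HF X AX.
  have [H1 _] := HF _ A1G; have [_ H2] := HG _ A2F.
  by rewrite invgM !mulgA in H1 H2 *.
- by have [H1 H2] := HF X AX; rewrite invgK.
Qed.

Lemma normaliser_closed A : is_subgroup A -> closure A `<=` A ->
  closure [set F | forall X, A X -> A (F * X * F^-1)%g /\ A (F^-1 * X * F)%g] `<=`
  [set F | forall X, A X -> A (F * X * F^-1)%g /\ A (F^-1 * X * F)%g].
Proof.
move=> gA cA F /closure_distC1 cF X AX; split; apply: closure_closed_mem => // e e0.
  have [d d0 dP] := conjg_continuous F X e0; have [G NG FG] := cF d d0.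
  by exists (G * X * G^-1)%g; [exact: (NG X AX).1|exact: dP].
have [d d0 dP] := conjg_continuous F^-1%g X e0.
have [d' d'0 d'P] := invg_continuous F d0; have [G NG FG] := cF d' d'0.
exists (G^-1 * X * G)%g; first exact: (NG X AX).2.
by have := dP _ (d'P _ FG); rewrite !invgK.
Qed.

Lemma commute_commutator (gT : groupType) (x y z : gT) : (y * z = z * y)%g ->
  (x * z * (y * (x * z)^-1 * y^-1) = x * y * x^-1 * y^-1)%g.
Proof. by move=> yz; rewrite invgM !mulgA -[(x * z * y)%g]mulgA -yz !mulgA mulgK. Qed.

(* Since r displaces the support of F and H, [F, r] is F times an element
   commuting with F and H, so that [[F, r], H] = [F, H]. *)
Lemma displaced_commutator A r a l1 l2 b : is_subgroup A ->
  a <= l1 -> l2 <= b -> l2 <= r l1 ->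
  (forall F, supported a b F -> A (F * r * F^-1)%g) ->
  forall F H, supported l1 l2 F -> supported l1 l2 H -> A (F * H * F^-1 * H^-1)%g.
Proof.
move=> /is_subgroupP[A1 AM AV] al lb l2r Ar F H Fs Hs.
have Ws G : supported l1 l2 G -> supported a b G by exact: supportedW.
pose K := (r * F^-1 * r^-1)%g.
have Ks : supported (r l1) (r l2) K by apply: supportedJ; exact: supportedV.
have HK : (H * K = K * H)%g by exact: supported_commute Hs Ks.
have Ar1 : A r by have := Ar 1%g (@supported1 _ a b); rewrite mul1g invg1 mulg1.
have AFr : A (F * K)%g.
  by have := AM _ _ (Ar F (Ws F Fs)) (AV _ Ar1); rewrite /K !mulgA.
(* This element equals (H r H^-1) ((H F) r (H F)^-1)^-1, a quotient of two conjugates of [r]. *)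
have AHFr : A (H * (F * K)^-1 * H^-1)%g.
  have := AM _ _ (Ar H (Ws H Hs)) (AV _ (Ar (H * F)%g (supportedM (Ws H Hs) (Ws F Fs)))).
  by rewrite /K !invgM !invgK !mulgA mulgVK.
have := AM _ _ AFr AHFr.
by rewrite commute_commutator.
Qed.

(** The fixed points are 0, 1 and 3/8, the centre of [1/4, 1/2]; points on either side of 3/8 are
    pushed towards 0 or 1. *)
Lemma expanding_diffeo : exists E, forall x, 0 <= x <= 1 ->
  E x = x + x * (1 - x) * (x - 3 / 8).
Proof.
have [||x x01|x x01|x x01|E EP] := @diff_of_derivative R
    (fun x => x + x * (1 - x) * (x - 3 / 8))
    (fun x => 1 + ((1 - x - x) * (x - 3 / 8) + x * (1 - x))).
- by rewrite !mul0r addr0.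
- by rewrite subrr mulr0 mul0r addr0.
- apply: is_derivID; first exact: is_derivI_id.
  have H1 := is_derivIB (is_derivI_cst 1 x) (is_derivI_id x).
  have H2 := is_derivIM x01 (is_derivI_id x) H1.
  have H3 := is_derivIB (is_derivI_id x) (is_derivI_cst (3 / 8) x).
  by apply: is_derivI_eq (is_derivIM x01 H2 H3); ring.
- by do ?[exact: contI_cst|exact: contI_id|apply: contIB => //|
    apply: contID => //|apply: contIM => //].
- by nra.
- by exists E => x x01; have [] := EP x x01.
Qed.

(** On [0, u1] the map contracts the distance to 0, and on [u2, 1] the distance to 1, by the factor
    1 - k at least; the two terms of [k] are the contraction rates at [u1] and [u2]. *)
Lemma expanding_diffeoX E u1 u2 a b :
  (forall x, 0 <= x <= 1 -> E x = x + x * (1 - x) * (x - 3 / 8)) ->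
  0 < u1 -> u1 < 3 / 8 -> 3 / 8 < u2 -> u2 < 1 -> 0 < a -> b < 1 ->
  exists n, (E ^+ n)%g u1 <= a /\ b <= (E ^+ n)%g u2.
Proof.
move=> EE u10 u1p pu2 u21 a0 b1.
pose k := Num.min ((1 - u1) * (3 / 8 - u1)) (u2 * (u2 - 3 / 8)).
have k0 : 0 < k by rewrite lt_min !mulr_gt0 ?subr_gt0 //; lra.
have k1 : k <= 1 by rewrite ge_min; apply/orP; left; nra.
have L x : 0 <= x <= u1 -> 0 <= E x <= x * (1 - k).
  move=> xu; rewrite EE; last lra.
  have ku : k <= (1 - u1) * (3 / 8 - u1) by rewrite ge_min lexx.
  have kx : k <= (1 - x) * (3 / 8 - x) by apply: le_trans ku _; apply: ler_pM; lra.
  by apply/andP; split; nra.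
have U x : u2 <= x <= 1 -> 0 <= 1 - E x <= (1 - x) * (1 - k).
  move=> xu; rewrite EE; last lra.
  have ku : k <= u2 * (u2 - 3 / 8) by rewrite ge_min lexx orbT.
  have kx : k <= x * (x - 3 / 8) by apply: le_trans ku _; apply: ler_pM; lra.
  rewrite (_ : 1 - _ = (1 - x) * (1 - x * (x - 3 / 8))); last by ring.
  have x1 : 0 <= 1 - x by lra.
  by rewrite ler_wpM2l ?mulr_ge0 //; [nra|lra].
have k1' : 0 <= 1 - k by rewrite subr_ge0.
have k1X n : (1 - k) ^+ n <= 1 by apply: exprn_ile1 => //; lra.
have k0X n : 0 <= (1 - k) ^+ n by exact: exprn_ge0.
have LX n : 0 <= (E ^+ n)%g u1 <= u1 * (1 - k) ^+ n.
  elim: n => [|n /andP[IH1 IH2]]; first by rewrite expg0 expr0 mulr1 lexx (ltW u10).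
  have [|H1 H2] := andP (L ((E ^+ n)%g u1) _).
    by rewrite IH1 (le_trans IH2) // ler_piMr // ltW.
  rewrite expgS diffC1M H1 (le_trans H2) // exprSr mulrA.
  by rewrite ler_wpM2r.
have UX n : 0 <= 1 - (E ^+ n)%g u2 <= (1 - u2) * (1 - k) ^+ n.
  elim: n => [|n /andP[IH1 IH2]]; first by rewrite expg0 expr0 mulr1 lexx subr_ge0 (ltW u21).
  have [|H1 H2] := andP (U ((E ^+ n)%g u2) _).
    have : (1 - u2) * (1 - k) ^+ n <= 1 - u2 by rewrite ler_piMr // subr_ge0 ltW.
    move: IH1 IH2; move: ((1 - u2) * _) ((E ^+ n)%g u2) => s t; lra.
  rewrite expgS diffC1M H1 (le_trans H2) // exprSr mulrA.
  by rewrite ler_wpM2r.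
have [||n nP] := @exprn_small (1 - k) (Num.min a (1 - b)) k1'; first lra.
  by rewrite lt_min a0 subr_gt0.
exists n; move: nP; rewrite le_min => /andP[na nb].
have /andP[_ H1] := LX n; have /andP[_ H2] := UX n; have k0n := k0X n.
by split; nra.
Qed.

(** A power of [E] stretches [u1, u2] over [a, b], so conjugation by its inverse brings the support
    of [F] into [u1, u2]. *)
Lemma expanding_generation A E u1 u2 : is_subgroup A -> A E ->
  (forall x, 0 <= x <= 1 -> E x = x + x * (1 - x) * (x - 3 / 8)) ->
  0 < u1 -> u1 < 3 / 8 -> 3 / 8 < u2 -> u2 < 1 ->
  (forall F, supported u1 u2 F -> A F) ->
  forall a b F, 0 < a -> b < 1 -> supported a b F -> A F.
Proof.
move=> /is_subgroupP[A1 AM AV] AE EE u10 u1p pu2 u21 AF a b F a0 b1 Fs.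
have [n [na nb]] := expanding_diffeoX EE u10 u1p pu2 u21 a0 b1.
have AEn k : A (E ^+ k)%g.
  by elim: k => [|k IHk]; [rewrite expg0|rewrite expgS; exact: AM].
pose W := (E ^+ n)%g.
rewrite (_ : F = W * (W^-1 * F * W^-1^-1) * W^-1)%g; last first.
  by rewrite invgK !mulgA mulgV mul1g mulgK.
apply/AM; last by apply: AV; exact: AEn.
apply/AM; first exact: AEn.
apply: AF; apply: supportedW (supportedJ W^-1%g Fs).
  by rewrite -(diff_le W) diffC1VK.
by rewrite -(diff_le W) diffC1VK.
Qed.
End generation.

(** * Tangency to the identity and derivatives at the endpoints *)

Section endpoint_derivatives.
Variable R : realType.
Implicit Types (A : set (diffC1 R)) (F G : diffC1 R) (x y a b c e : R) (n : nat).

(** The difference of positive parts is the soft threshold sign(w) max(0, |w| - d), in a form whose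
    continuity is immediate. *)
Lemma soft_threshold (w d : R) : 0 <= d ->
  `|Num.max 0 (w - d) - Num.max 0 (- w - d) - w| <= d /\
  (`|w| <= d -> Num.max 0 (w - d) - Num.max 0 (- w - d) = 0).
Proof.
move=> d0; split; last first.
  by rewrite ler_norml => /andP[? ?]; rewrite !max_l ?subrr //; lra.
rewrite ler_norml; have [w1|w1] := leP 0 (w - d); have [w2|w2] := leP 0 (- w - d);
  by apply/andP; split; lra.
Qed.

(** The bounds 1/4 and 3/4 keep the two end zones clear of a correcting bump in [1/4, 3/4]. *)
Lemma small_near_endpoints (w : R -> R) (d : R) : (forall x, 0 <= x <= 1 -> contI w x) ->
  w 0 = 0 -> w 1 = 0 -> 0 < d -> exists a b, [/\ 0 < a <= 1 / 4, 3 / 4 <= b < 1 &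
    forall x, 0 <= x <= 1 -> x <= a \/ b <= x -> `|w x| <= d].
Proof.
move=> cw w0 w1 d0.
have [|d1 d10 d1P] := cw 0 _ d d0; first by rewrite lexx ler01.
have [|d2 d20 d2P] := cw 1 _ d d0; first by rewrite lexx ler01.
exists (Num.min (d1 / 2) (1 / 4)), (Num.max (1 - d2 / 2) (3 / 4)); split.
- by rewrite lt_min ge_min lexx orbT andbT divr_gt0 //=; lra.
- by rewrite gt_max le_max lexx orbT /=; apply/andP; split; lra.
- move=> x x01; rewrite le_min ge_max => -[/andP[xd _]|/andP[xd _]].
    by have := d1P x x01; rewrite w0 !subr0; apply; rewrite ger0_norm; lra.
  by have := d2P x x01; rewrite w1 subr0; apply; rewrite ler0_norm; lra.
Qed.

Lemma between_bump a b x : 0 < a <= 1 / 4 -> 3 / 4 <= b < 1 -> x <= a \/ b <= x ->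
  x <= 1 / 4 \/ 3 / 4 <= x.
Proof. by move=> ? ? [?|?]; [left|right]; lra. Qed.

(* Replace F' - 1 by its soft threshold, which vanishes near both endpoints, and
   restore the integral with a bump in the middle. *)
Lemma tangent_limit F e : derivI F 0 = 1 -> derivI F 1 = 1 -> 0 < e ->
  exists a b G, [/\ 0 < a, b < 1, supported a b G & distC1 F G <= e].
Proof.
move=> F0 F1 e0.
have [|||B [db [B0 B1 dB cdb [db0 dbout]]]] := @bump_step R (1 / 4) (3 / 4); try lra.
have [M M0 MP] := contI_bounded cdb.
have [m m0 mP] := contI_gt0_min (@diff_deriv_cont _ F) (@diff_deriv_gt0 _ F).
(* Thresholding changes the derivative by at most [d], the bump correction by at most [d * M]; the
   sum must be at most [e], and at most [m / 2] for positivity. *)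
pose d := Num.min e (m / 2) / (1 + M).
have M1 : 0 < 1 + M by rewrite addr_gt0.
have d0 : 0 < d by rewrite divr_gt0 // lt_min e0 divr_gt0.
have [de dm] : d * (1 + M) <= e /\ d * (1 + M) <= m / 2.
  by rewrite divfK ?gt_eqF // !ge_min !lexx orbT.
pose w x := derivI F x - 1.
pose w0 x := Num.max 0 (w x - d) - Num.max 0 (- w x - d).
have cw x : 0 <= x <= 1 -> contI w x.
  by move=> x01; apply: contIB => //; [exact: diff_deriv_cont|exact: contI_cst].
have cw0 x : 0 <= x <= 1 -> contI w0 x.
  move=> x01; apply: contIB => //; apply: contI_max => //; try exact: contI_cst.
    by apply: contIB => //; [exact: cw|exact: contI_cst].
  by apply: contIB => //; [apply: contIN => //; exact: cw|exact: contI_cst].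
have w0w x : `|w0 x - w x| <= d by have [] := soft_threshold (w x) (ltW d0).
have w00 x : `|w x| <= d -> w0 x = 0 by have [_] := soft_threshold (w x) (ltW d0).
have [P [P0 dP]] := continuous_antiderivative cw0.
(* F' - 1 has integral 0, so thresholding leaves a defect of at most [d]. *)
have P1 : `|P 1| <= d.
  have := @is_derivI_lipschitz _ (fun x => P x - (F x - x)) (fun x => w0 x - w x)
    0 1 d (lexx _) (lexx _) _ (fun x _ => w0w x) 0 1.
  rewrite P0 diffC1_0 diffC1_1 !subrr !subr0 normr1 mulr1; apply; rewrite ?lexx ?ler01 //.
  move=> x x01; apply: is_derivIB; first exact: dP.
  by apply: is_derivIB; [exact: diff_is_derivI|exact: is_derivI_id].
pose dG x := 1 + w0 x - P 1 * db x.
have dGF x : 0 <= x <= 1 -> `|derivI F x - dG x| <= d * (1 + M).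
  move=> x01; rewrite (_ : _ - _ = P 1 * db x - (w0 x - w x)); last by rewrite /dG /w; ring.
  rewrite (le_trans (ler_normB _ _)) // mulrDr mulr1 addrC lerD // normrM.
  by apply: ler_pM => //; exact: MP.
have [||x x01|x x01|x x01|G GP] := @diff_of_derivative R (fun x => x + P x - P 1 * B x) dG.
- by rewrite P0 B0 mulr0 addr0 subr0.
- by rewrite B1 mulr1 addrK.
- apply: is_derivIB; last by apply: is_derivIZ; exact: dB.
  by apply: is_derivID; [exact: is_derivI_id|exact: dP].
- apply: contIB => //; last by apply: contIM => //; [exact: contI_cst|exact: cdb].
  by apply: contID => //; [exact: contI_cst|exact: cw0].
- have := dGF x x01; have := mP x x01; rewrite ler_norml.
  by move: (dG x) (derivI F x) (d * (1 + M)) dm m0 => u v z; clear; lra.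
have [wz0 wz1] : w 0 = 0 /\ w 1 = 0 by rewrite /w F0 F1 subrr.
have [a [b [ab b34 wab]]] := small_near_endpoints cw wz0 wz1 d0.
exists a, b, G; split; [by case/andP: ab|by case/andP: b34| |].
  apply: deriv1_supported; [by case/andP: ab => /ltW|by case/andP: b34 => _ /ltW|].
  move=> x x01 xab; rewrite (GP x x01).2 /dG w00 ?wab // dbout ?mulr0 ?subr0 ?addr0 //.
  by move: ab b34 xab; exact: between_bump.
by apply: distC1_le => x x01; rewrite (GP x x01).2; apply: le_trans de; exact: dGF.
Qed.

Lemma affine_gt0 (c u : R) : -1 < c -> c < 3 -> u <= 1 -> - 1 <= 3 * u -> 0 < 1 + c * u.
Proof.
move=> c1 c3 u1 u3; have [c0|c0] := leP 0 c.
  have : 0 <= c * (3 * u + 1) by rewrite mulr_ge0 //; lra.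
  lra.
have : 0 <= - c * (1 - u) by rewrite mulr_ge0 //; lra.
lra.
Qed.

(** The cubic x (1 - x)^2 has derivative 1 at 0 and 0 at 1, with values in [-1/3, 1]; hence the
    range -1 < c < 3 and the distance bound. *)
Lemma left_endpoint_diffeo c : -1 < c -> c < 3 -> exists G,
  [/\ derivI G 0 = 1 + c, derivI G 1 = 1 & distC1 1%g G <= `|c|].
Proof.
move=> c1 c3.
have [||x x01|x x01|x x01|G GP] := @diff_of_derivative R
    (fun x => x + c * (x * ((1 - x) * (1 - x)))) (fun x => 1 + c * ((1 - x) * (1 - 3 * x))).
- by rewrite mul0r mulr0 addr0.
- by rewrite subrr !mulr0 addr0.
- apply: is_derivID; first exact: is_derivI_id.
  have H1 := is_derivIB (is_derivI_cst 1 x) (is_derivI_id x).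
  have H2 := is_derivIM x01 (is_derivI_id x) (is_derivIM x01 H1 H1).
  by apply: is_derivI_eq (@is_derivIZ _ c _ _ _ H2); congr (c * _); ring.
- by do ?[exact: contI_cst|exact: contI_id|apply: contIB => //|
    apply: contID => //|apply: contIM => //].
- have h1 : (1 - x) * (1 - 3 * x) <= 1 by nra.
  have h2 : - 1 <= 3 * ((1 - x) * (1 - 3 * x)) by have := sqr_ge0 (3 * x - 2); rewrite expr2; nra.
  exact: affine_gt0.
have GP' x x01 := (GP x x01).2; exists G; split.
- by rewrite GP' ?lexx ?ler01 // !subr0 mulr0 subr0 !mulr1.
- by rewrite GP' ?lexx ?ler01 // subrr mul0r mulr0 addr0.
- apply: distC1_le => x x01; rewrite deriv_one // GP' // opprD addrA subrr sub0r normrN normrM.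
  by rewrite ler_piMr // ler_norml; apply/andP; split; nra.
Qed.

Lemma right_endpoint_diffeo c : -1 < c -> c < 3 -> exists G,
  [/\ derivI G 0 = 1, derivI G 1 = 1 + c & distC1 1%g G <= `|c|].
Proof.
move=> c1 c3.
have [||x x01|x x01|x x01|G GP] := @diff_of_derivative R
    (fun x => x + c * (x * x * (x - 1))) (fun x => 1 + c * (x * (3 * x - 2))).
- by rewrite !mul0r mulr0 addr0.
- by rewrite subrr !mulr0 addr0.
- apply: is_derivID; first exact: is_derivI_id.
  have H1 := is_derivIB (is_derivI_id x) (is_derivI_cst 1 x).
  have H2 := is_derivIM x01 (is_derivIM x01 (is_derivI_id x) (is_derivI_id x)) H1.
  by apply: is_derivI_eq (@is_derivIZ _ c _ _ _ H2); congr (c * _); ring.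
- by do ?[exact: contI_cst|exact: contI_id|apply: contIB => //|
    apply: contID => //|apply: contIM => //].
- have h1 : x * (3 * x - 2) <= 1 by nra.
  have h2 : - 1 <= 3 * (x * (3 * x - 2)) by have := sqr_ge0 (3 * x - 1); rewrite expr2; nra.
  exact: affine_gt0.
have GP' x x01 := (GP x x01).2; exists G; split.
- by rewrite GP' ?lexx ?ler01 // mul0r mulr0 addr0.
- by rewrite GP' ?lexx ?ler01 //; ring.
- apply: distC1_le => x x01; rewrite deriv_one // GP' // opprD addrA subrr sub0r normrN normrM.
  by rewrite ler_piMr // ler_norml; apply/andP; split; nra.
Qed.

(* L contains s (sqrt 2 - 1)^n. *)
Lemma sqrt2_dense (L : set R) (s t e : R) : 0 < s -> 0 < e ->
  (forall x y, L x -> L y -> L (x - y)) -> L s -> L (s * Num.sqrt 2) ->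
  exists2 l, L l & `|t - l| <= e.
Proof.
move=> s0 e0 LB Ls Ls2; set q := Num.sqrt 2 in Ls2.
have L0 : L 0 by rewrite -(subrr s); exact: LB.
have LN x : L x -> L (- x) by move=> Lx; rewrite -sub0r; exact: LB.
have LD x y : L x -> L y -> L (x + y) by move=> Lx Ly; rewrite -[y]opprK; exact/LB/LN.
have Lnat x k : L x -> L (x *+ k).
  by move=> Lx; elim: k => [|k IHk]; rewrite ?mulr0n // mulrS; exact: LD.
have Lint x (k : int) : L x -> L (x *~ k).
  move=> Lx; case: k => k; first by rewrite -pmulrn; exact: Lnat.
  by rewrite NegzE mulrNz -pmulrn; apply: LN; exact: Lnat.
have qq : q * q = 2 by rewrite -expr2 sqr_sqrtr.
have q0 : 0 <= q by exact: sqrtr_ge0.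
have q1 : 1 < q by rewrite -(@ltr_pXn2r _ 2) ?nnegrE // expr1n expr2 qq; lra.
have q2 : q < 2 by rewrite -(@ltr_pXn2r _ 2) ?nnegrE // !expr2 qq; lra.
have Lq n : L (s * (q - 1) ^+ n) /\ L (s * (q - 1) ^+ n * q).
  elim: n => [|n [IH1 IH2]]; first by rewrite expr0 mulr1.
  rewrite exprSr mulrA; move: (s * _) IH1 IH2 => x Lx Lxq; split.
    by rewrite mulrBr mulr1; exact: LB.
  by rewrite (_ : _ * q = x * (q * q) - x * q); [rewrite qq mulr_natr; exact/LB/Lxq/Lnat|ring].
have [||n nP] := @exprn_small _ (q - 1) (e / s) _ _ (divr_gt0 e0 s0); [lra|lra|].
pose th := s * (q - 1) ^+ n.
have th0 : 0 < th by rewrite mulr_gt0 // exprn_gt0 // subr_gt0.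
have the : th <= e by rewrite /th mulrC -ler_pdivlMr.
have [Lth _] := Lq n; rewrite -/th in Lth.
exists (th *~ Num.floor (t / th)); first exact: Lint.
apply: le_trans the; have := floor_itv (t / th); rewrite intrD -mulrzr.
set f : R := (Num.floor _)%:~R; rewrite ler_pdivlMr // ltr_pdivrMr // => /andP[H1 H2].
by rewrite ler_norml; apply/andP; split; lra.
Qed.

(** At the common fixed points [p] and [q] the logarithmic derivative is a homomorphism. The points
    are parameters so as to treat both endpoints at once. *)
Lemma log_deriv_subgroup A (p q : R) : is_subgroup A -> 0 <= p <= 1 -> 0 <= q <= 1 ->
  (forall F, F p = p) -> (forall F, F q = q) ->
  forall x y, (exists2 F, A F & log_deriv F p = x /\ log_deriv F q = 0) ->
    (exists2 F, A F & log_deriv F p = y /\ log_deriv F q = 0) ->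
    exists2 F, A F & log_deriv F p = x - y /\ log_deriv F q = 0.
Proof.
move=> /is_subgroupP[A1 AM AV] p01 q01 fp fq x y [F AF [Fp Fq]] [G AG [Gp Gq]].
have GV r : 0 <= r <= 1 -> G r = r -> log_deriv G^-1%g r = - log_deriv G r.
  move=> r01 Gr; have := log_deriv_mulg G^-1%g G r01.
  by rewrite mulVg Gr /log_deriv deriv_one // ln1 => /eqP; rewrite eq_sym addr_eq0 => /eqP.
exists (F * G^-1)%g; first by apply: AM => //; exact: AV.
by rewrite !log_deriv_mulg // !fp !fq !GV // Fp Fq Gp Gq subr0.
Qed.

Lemma endpoint_log_derivs_dense A (p q t e : R) : is_subgroup A -> 0 <= p <= 1 -> 0 <= q <= 1 ->
  (forall F, F p = p) -> (forall F, F q = q) -> 0 < e ->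
  (exists2 F, A F & derivI F p = 2 /\ derivI F q = 1) ->
  (exists2 F, A F & derivI F p = 2 `^ Num.sqrt 2 /\ derivI F q = 1) ->
  exists2 F, A F & `|t - log_deriv F p| <= e /\ derivI F q = 1.
Proof.
move=> gA p01 q01 fp fq e0 [F1 AF1 [F1p F1q]] [F2 AF2 [F2p F2q]].
pose L := [set x | exists2 F, A F & log_deriv F p = x /\ log_deriv F q = 0].
have [||||l [F AF [<- Fq]] lt] := @sqrt2_dense L (ln 2) t e _ e0.
- by apply: ln_gt0; lra.
- exact: log_deriv_subgroup.
- by exists F1 => //; rewrite /log_deriv F1p F1q ln1.
- by exists F2 => //; rewrite /log_deriv F2p F2q ln1 ln_powR mulrC.
- exists F => //; split=> //.
  by move: Fq => /(congr1 expR); rewrite /log_deriv expR0 lnK // posrE diff_deriv_gt0.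
Qed.

(** Elements [G], [H] of [A] approximate the derivatives of [F] at 0 and at 1. Multiplying [F] by X
    Y, close to 1, makes these derivatives equal to those of G H, so (G H)^-1 F X Y is tangent to
    the identity at both endpoints and lies in [A]. *)
Lemma endpoint_generation A F : is_subgroup A -> closure A `<=` A ->
  (forall G, derivI G 0 = 1 -> derivI G 1 = 1 -> A G) ->
  (exists2 G, A G & derivI G 0 = 2 /\ derivI G 1 = 1) ->
  (exists2 G, A G & derivI G 0 = 2 `^ Num.sqrt 2 /\ derivI G 1 = 1) ->
  (exists2 G, A G & derivI G 1 = 2 /\ derivI G 0 = 1) ->
  (exists2 G, A G & derivI G 1 = 2 `^ Num.sqrt 2 /\ derivI G 0 = 1) ->
  A F.
Proof.
move=> gA cA AT A1 A2 A3 A4; apply: closure_closed_mem => // e e0.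
have i0 : 0 <= (0 : R) <= 1 by rewrite lexx ler01.
have i1 : 0 <= (1 : R) <= 1 by rewrite lexx ler01.
have [d1 d10 d1P] := mulg_continuous_r F 1%g e0.
have [d2 d20 d2P] := mulg_continuous 1%g 1%g d10.
pose d3 := Num.min d2 (1 / 2).
have d30 : 0 < d3 by rewrite lt_min d20 divr_gt0.
have [d d0 dP] := expR_near0 d30.
have adj p (G : diffC1 R) : 0 <= p <= 1 -> `|log_deriv F p - log_deriv G p| <= d ->
    exists c, [/\ -1 < c, c < 3, `|c| <= d2 & derivI F p * (1 + c) = derivI G p].
  move=> p01 Fp; exists (derivI G p / derivI F p - 1).
  have Fp0 := diff_deriv_gt0 F p01; have Gp0 := diff_deriv_gt0 G p01.
  have : `|derivI G p / derivI F p - 1| <= d3.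
    rewrite (_ : _ / _ = expR (log_deriv G p - log_deriv F p)).
      by apply: dP; rewrite distrC.
    by rewrite expRD expRN /log_deriv !lnK.
  rewrite le_min => /andP[H1]; rewrite ler_norml => H2; split=> //; try lra.
  by rewrite addrC subrK mulrC divfK // gt_eqF.
have [G AG [Gt G1]] := @endpoint_log_derivs_dense A 0 1 (log_deriv F 0) d gA i0 i1
  (@diffC1_0 R) (@diffC1_1 R) d0 A1 A2.
have [H AH [Ht H0]] := @endpoint_log_derivs_dense A 1 0 (log_deriv F 1) d gA i1 i0
  (@diffC1_1 R) (@diffC1_0 R) d0 A3 A4.
have [c [c1 c3 cd Fc]] := adj 0 G i0 Gt.
have [c' [c'1 c'3 c'd Fc']] := adj 1 H i1 Ht.
have [X [X0 X1 Xd]] := left_endpoint_diffeo c1 c3.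
have [Y [Y0 Y1 Yd]] := right_endpoint_diffeo c'1 c'3.
have /is_subgroupP[_ AM AV] := gA.
exists (F * (X * Y))%g; last first.
  rewrite -{1}[F]mulg1; apply: d1P; rewrite -{1}[1%g]mulg1.
  by apply: d2P; [exact: le_trans Xd cd|exact: le_trans Yd c'd].
rewrite -(mulVKg (G * H)%g (F * (X * Y))%g); apply: (AM _ _ (AM _ _ AG AH)).
have inv0 (K : diffC1 R) : derivI K^-1%g 0 = (derivI K 0)^-1 by rewrite -{1}(diffC1_0 K) deriv_invg.
have inv1 (K : diffC1 R) : derivI K^-1%g 1 = (derivI K 1)^-1 by rewrite -{1}(diffC1_1 K) deriv_invg.
have Gn0 : derivI G 0 != 0 by rewrite gt_eqF // diff_deriv_gt0.
have Hn0 : derivI H 1 != 0 by rewrite gt_eqF // diff_deriv_gt0.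
apply: AT.
  rewrite deriv_mulg // diffC1_0 inv0 !deriv_mulg // !diffC1_0 H0 X0 Y0 !mulr1 Fc.
  by rewrite mulVf.
rewrite deriv_mulg // diffC1_1 inv1 !deriv_mulg // !diffC1_1 G1 X1 Y1 !mul1r Fc'.
by rewrite mulVf.
Qed.
End endpoint_derivatives.

(** * Assembly of the generators *)

Lemma in_generated_subgroup (gT : groupType) (S : set gT) : S `<=` generated_subgroup S.
Proof. by move=> x Sx H [_]; exact. Qed.

(** [h] preserves [a, b], hence so does [W], and conjugating an element supported there only
    involves the restriction to [a, b]. *)
Lemma conjg_eq_on (R : realType) (a b : R) (W h X : diffC1 R) : a <= b ->
  (forall x, a <= x <= b -> W x = h x) -> supported a b h -> supported a b X ->
  (W * X * W^-1 = h * X * h^-1 /\ W^-1 * X * W = h^-1 * X * h)%g.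
Proof.
have out (F : diffC1 R) x : supported a b F -> ~~ (a <= x <= b) -> F x = x.
  by move=> Fs; rewrite negb_and -!ltNge => /orP[]/ltW; [apply: (Fs x).1|apply: (Fs x).2].
move=> ab; have inv (U k : diffC1 R) : (forall x, a <= x <= b -> U x = k x) ->
    supported a b k -> forall x, a <= x <= b -> U^-1%g x = k^-1%g x.
  move=> Uk ks x xab; apply: (@diff_inj R U); rewrite diffC1VK Uk ?diffC1VK //.
  by rewrite (supported_itv x (supportedV ks)).
have main (U k : diffC1 R) : (forall x, a <= x <= b -> U x = k x) ->
    supported a b k -> supported a b X -> (U * X * U^-1 = k * X * k^-1)%g.
  move=> Uk ks Xs; have Vs := supportedV ks; apply: diffC1_ext => x; rewrite !diffC1M.
  have [xab|xab] := boolP (a <= x <= b).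
    by rewrite (inv U k) // Uk // (supported_itv _ Xs) // (supported_itv _ Vs).
  rewrite (out _ x Vs) // (out _ x Xs) // (out _ x ks) // (out X) ?diffC1VK //.
  by apply: contra xab => H; rewrite -(diffC1VK U x) Uk // (supported_itv _ ks).
move=> Wh hs Xs; split; first exact: main.
have := main W^-1%g h^-1%g (inv W h Wh hs) (supportedV hs) Xs.
by rewrite !invgK.
Qed.

(** The upper bound 4 comes from the endpoint diffeomorphisms, whose derivative 1 + c is constrained
    by c < 3. *)
Lemma powR2_sqrt2_bounds (R : realType) : 1 < (2 : R) `^ Num.sqrt 2 /\ (2 : R) `^ Num.sqrt 2 < 4.
Proof.
have pE (u : R) : 2 `^ u = expR (u * ln 2) by rewrite /powR pnatr_eq0.
have l2 : 0 < ln 2 :> R by apply: ln_gt0; lra.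
have s1 : 0 < Num.sqrt 2 :> R by rewrite sqrtr_gt0; lra.
have s2 : Num.sqrt 2 < 2 :> R.
  by rewrite -(@ltr_pXn2r _ 2) ?nnegrE ?sqrtr_ge0 // sqr_sqrtr ?expr2; lra.
split; first by rewrite pE expR_gt1 mulr_gt0.
rewrite (_ : 4 = 2 `^ 2 :> R); last by rewrite powR_mulrn // expr2; ring.
by rewrite !pE ltr_expR ltr_pM2r.
Qed.

Lemma endpoint_generators (R : realType) : exists X1 X2 Y1 Y2 : diffC1 R,
  [/\ derivI X1 0 = 2 /\ derivI X1 1 = 1, derivI X2 0 = 2 `^ Num.sqrt 2 /\ derivI X2 1 = 1,
      derivI Y1 1 = 2 /\ derivI Y1 0 = 1 & derivI Y2 1 = 2 `^ Num.sqrt 2 /\ derivI Y2 0 = 1].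
Proof.
have [p1 p2] := powR2_sqrt2_bounds R.
have ex c : 1 < c -> c < 4 -> (exists X : diffC1 R, derivI X 0 = c /\ derivI X 1 = 1) /\
    (exists Y : diffC1 R, derivI Y 1 = c /\ derivI Y 0 = 1).
  move=> c1 c4; have [m1 m3] : -1 < c - 1 /\ c - 1 < 3 by split; lra.
  have [X [X0 X1 _]] := left_endpoint_diffeo m1 m3.
  have [Y [Y0 Y1 _]] := right_endpoint_diffeo m1 m3.
  by split; [exists X; rewrite X0 X1|exists Y; rewrite Y0 Y1]; split=> //; rewrite addrC subrK.
have [||[X1 X1P] [Y1 Y1P]] := ex 2; [lra|lra|].
have [[X2 X2P] [Y2 Y2P]] := ex _ p1 p2.
by exists X1, X2, Y1, Y2.
Qed.

Section compactly_supported_generation.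
Variables (R : realType) (A : set (diffC1 R)) (gA : is_subgroup A) (cA : closure A `<=` A).
Variables (T g r : diffC1 R) (h : nat -> diffC1 R) (a b : R).
Hypothesis ab : a <= b.
Hypotheses (AT : A T) (Ag : A g) (Ar : A r).
Hypothesis hs : forall n, supported a b (h n).
Hypothesis h_gen : forall B : set (diffC1 R), is_subgroup B -> closure B `<=` B ->
  (forall n, B (h n)) -> forall F, supported a b F -> B F.
Hypothesis gP : forall n x, a <= x <= b -> ((T ^+ n)^-1 * g * T ^+ n)%g x = h n x.
Hypothesis rs : supported a b r.

(** The elements [h n] are not known to lie in [A], but on the elements of [A] supported in [a, b]
    they act by conjugation as T^-n g T^n does. The normaliser of these elements is a closed
    subgroup containing all [h n], hence every [F] supported in [a, b]. *)
Lemma conjg_mem F : supported a b F -> A (F * r * F^-1)%g.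
Proof.
have /is_subgroupP[A1 AM AV] := gA.
pose B : set (diffC1 R) := A `&` supported a b.
have gB : is_subgroup B.
  apply/is_subgroupP; split=> [|F1 G [AF JF] [AG JG]|F1 [AF JF]]; split=> /=.
  - exact: A1.
  - exact: supported1.
  - exact: (AM _ _ AF AG).
  - exact: supportedM.
  - exact: AV.
  - exact: supportedV.
have cB : closure B `<=` B.
  move=> F1 cF; split; first by apply: cA; apply: closure_subset cF; exact: subIsetl.
  by apply: (@supported_closed R); apply: closure_subset cF; exact: subIsetr.
have ATn n : A (T ^+ n)%g.
  by elim: n => [|n IHn]; [rewrite expg0|rewrite expgS; exact: (AM _ _ AT IHn)].
have hB n X : B X -> B (h n * X * (h n)^-1)%g /\ B ((h n)^-1 * X * h n)%g.
  move=> [AX JX]; pose W := ((T ^+ n)^-1 * g * T ^+ n)%g.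
  have AW : A W by exact: (AM _ _ (AM _ _ (AV _ (ATn n)) Ag) (ATn n)).
  have [E1 E2] := conjg_eq_on ab (gP n) (hs n) JX.
  have hV := supportedV (hs n).
  split; split.
  - by rewrite -E1; exact: (AM _ _ (AM _ _ AW AX) (AV _ AW)).
  - by apply: supportedM => //; exact: supportedM.
  - by rewrite -E2; exact: (AM _ _ (AM _ _ (AV _ AW) AX) AW).
  - by apply: supportedM => //; exact: supportedM.
move=> Fs; have N := h_gen (normaliser_is_subgroup gB) (normaliser_closed gB cB) hB Fs.
by have [[]] := N r (conj Ar rs).
Qed.
End compactly_supported_generation.

(** At 3/8 the bump moves points by 64 (1/64)^2 = 1/64. With e = 1/160 the interval has length 1/80,
    still less than the displacement at its left end. *)
Lemma bump_displaces (R : realType) : exists2 e : R, 0 < e < 1 / 8 &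
  3 / 8 + e <= 3 / 8 - e +
    (1 / 2 - 1 / 4) ^- 3 * Num.max 0 ((3 / 8 - e - 1 / 4) * (1 / 2 - (3 / 8 - e))) ^+ 2.
Proof.
exists (1 / 160); first by apply/andP; split; lra.
rewrite max_r; last by lra.
by rewrite (_ : (1 / 2 - 1 / 4) ^- 3 = 64 :> R); [lra|field].
Qed.

(** The intervals around 3/8 shrink at each stage: commutators on [3/8 - e, 3/8 + e], parabolic
    elements after giving up room on the left for the conjugators, then all diffeomorphisms on an
    interval interior to the previous one, which [E] finally spreads. *)
Lemma compactly_supported_generation (R : realType) (A : set (diffC1 R))
    (T g r E : diffC1 R) (h : nat -> diffC1 R) :
  is_subgroup A -> closure A `<=` A -> A T -> A g -> A r -> A E ->
  (forall n, supported (1 / 4) (1 / 2) (h n)) ->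
  (forall B : set (diffC1 R), is_subgroup B -> closure B `<=` B ->
    (forall n, B (h n)) -> forall F, supported (1 / 4) (1 / 2) F -> B F) ->
  (forall n x, 1 / 4 <= x <= 1 / 2 -> ((T ^+ n)^-1 * g * T ^+ n)%g x = h n x) ->
  supported (1 / 4) (1 / 2) r ->
  (forall x, 0 <= x <= 1 ->
    r x = x + (1 / 2 - 1 / 4) ^- 3 * Num.max 0 ((x - 1 / 4) * (1 / 2 - x)) ^+ 2) ->
  (forall x, 0 <= x <= 1 -> E x = x + x * (1 - x) * (x - 3 / 8)) ->
  forall a b F, 0 < a -> b < 1 -> supported a b F -> A F.
Proof.
move=> gA cA AT Ag Ar AE hs h_gen gP rs rE EE.
have J : 1 / 4 <= 1 / 2 :> R by lra.
have Arc := conjg_mem gA cA J AT Ag Ar hs h_gen gP rs.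
have [e /andP[e0 e8] re] := bump_displaces R.
have AC : forall F G, supported (3 / 8 - e) (3 / 8 + e) F ->
    supported (3 / 8 - e) (3 / 8 + e) G -> A (F * G * F^-1 * G^-1)%g.
  apply: (@displaced_commutator R A r (1 / 4) _ _ (1 / 2) gA _ _ _ Arc); [lra|lra|].
  by rewrite rE; [exact: re|lra].
have AP F : supported (3 / 8 - e / 2) (3 / 8 + e) F -> parabolic F -> A F.
  by apply: (@commutators_generate R A (3 / 8 - e) _ _ F _ _ _ _ cA AC); lra.
have AL : forall F, supported (3 / 8 - e / 4) (3 / 8 + e / 2) F -> A F.
  by apply: (@parabolic_generation R A (3 / 8 - e / 2) (3 / 8 + e) _ _ _ _ _ _ _ gA AP); lra.
by apply: (@expanding_generation R A E (3 / 8 - e / 4) (3 / 8 + e / 2) gA AE EE _ _ _ _ AL); lra.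
Qed.

Theorem theorem1p1 (R : realType) :
  exists G : set (diffC1 R), [/\ is_subgroup G, finitely_generated G & dense G].
Proof.
have [T TP] := halving_diffeo R.
have [h [hs h0 h_gen]] := @null_sequence_generates R (1 / 4) (1 / 2).
have [g gP] := encode_null_sequence TP hs h0.
have [|||r [rs _ rE]] := @bump_diffeo R (1 / 4) (1 / 2); [lra|lra|lra|].
have [E EE] := expanding_diffeo R.
have [X1 [X2 [Y1 [Y2 [X1P X2P Y1P Y2P]]]]] := endpoint_generators R.
pose S := [set` [:: T; g; r; E; X1; X2; Y1; Y2]].
pose H := generated_subgroup S; have gH : is_subgroup H := generated_is_subgroup S.
exists H; split=> //; first by exists S; split=> //; exact: finite_seq.
(* Density of [H] means that the closed subgroup [A] is everything, so limits are taken freely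
   inside [A]. *)
pose A := closure H; have gA : is_subgroup A := is_subgroup_closure gH.
have cA : closure A `<=` A by rewrite -(closure_id A).1 //; exact: closed_closure.
have SA (F : diffC1 R) : F \in [:: T; g; r; E; X1; X2; Y1; Y2] -> A F.
  by move=> FS; apply: subset_closure; exact: in_generated_subgroup.
have [[AT Ag Ar AE] [AX1 AX2 AY1 AY2]] :
    [/\ A T, A g, A r & A E] /\ [/\ A X1, A X2, A Y1 & A Y2].
  by do 2!split; apply: SA; rewrite !inE eqxx ?orbT.
have Acomp := compactly_supported_generation gA cA AT Ag Ar AE hs h_gen gP rs rE EE.
have Atan (F : diffC1 R) : derivI F 0 = 1 -> derivI F 1 = 1 -> A F.
  move=> F0 F1; apply: closure_closed_mem => // e e0.
  have [a [b [G [a0 b1 Gs FG]]]] := tangent_limit F0 F1 e0.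
  by exists G => //; exact: Acomp Gs.
have Aall (F : diffC1 R) : A F.
  by apply: endpoint_generation => //; [exists X1|exists X2|exists Y1|exists Y2].
move=> O [F OF] oO; have [|G [HG OG]] := Aall F O; first exact: open_nbhs_nbhs.
by exists G.
Qed.
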